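(* Let $R$ be a prime PI-ring with center $Z$, extended centroid $C$ and central closure $R_C$. Then: (a) the central closure $R_C$ is a finite-dimensional central simple algebra over $C$; (b) every nonzero (two-sided) ideal $I$ of $R$ intersects the center $Z$ of $R$ nontrivially, i.e. $I\cap Z\neq 0$; (c) $C$ is the field of fractions of $Z$ (where $Z$ is regarded as a subring of the field $C$); (d) every element in $R_C$ is of the form $z^{-1}r$ with $0\neq z\in Z$, $r\in R$ (where $z^{-1}$ is the inverse of $z$ in $C$).
   Context: Rings are associative and not assumed to have a unit element; ''ideal'' means two-sided ideal. A (nonzero) ring $R$ is prime if the product of any two nonzero ideals of $R$ is nonzero. For a prime ring $R$, the symmetric Martindale ring of quotients $Q=Q_s(R)$ is the ring with $1$ that is characterized, up to isomorphism, by the following four properties: (1) $R$ is a subring of $Q$; (2) for every $q\in Q$ there exists a nonzero ideal $I$ of $R$ such that $qI\cup Iq\subseteq R$; (3) if $I$ is a nonzero ideal of $R$ and $0\neq q\in Q$, then $qI\neq 0$ and $Iq\neq 0$; (4) if $I$ is a nonzero ideal of $R$, $f:I\to R$ is a right $R$-module homomorphism, and $g:I\to R$ is a left $R$-module homomorphism such that $xf(y)=g(x)y$ for all $x,y\in I$, then there exists $q\in Q$ such that $f(y)=qy$ and $g(x)=xq$ for all $x,y\in I$. The extended centroid $C$ of $R$ is the center of $Q$; it is a field containing the center $Z$ of $R$, and $Q$ is regarded as an algebra over $C$. The central closure $R_C$ of $R$ is the $C$-subalgebra of $Q$ consisting of all finite sums $\sum_i\lambda_i r_i$ with $\lambda_i\in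 C$, $r_i\in R$. Let $C\langle X_1,X_2,\ldots\rangle$ be the free (noncommutative, unital) algebra over $C$ generated by indeterminates $X_1,X_2,\ldots$. An element $f=f(X_1,\ldots,X_n)$ of it is an identity of $R$ if $f(r_1,\ldots,r_n)=0$ for all $r_1,\ldots,r_n\in R$ (evaluated in the $C$-algebra $Q$). A prime ring $R$ with extended centroid $C$ is a PI-ring if some nonzero polynomial in $C\langle X_1,X_2,\ldots\rangle$ is an identity of $R$. A central simple algebra over a field $C$ is a $C$-algebra with $1$ which is simple as a ring and whose center consists exactly of the scalar multiples of $1$. *)

(* Defs.v *)
From mathcomp Require Import all_boot all_algebra.
From mathcomp Require Import boolp classical_sets.
From mathcomp.multinomials Require Import monalg.

Set Implicit Arguments.
Unset Strict Implicit.
Unset Printing Implicit Defensive.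

Import GRing.Theory.

Local Open Scope classical_set_scope.
Local Open Scope ring_scope.

(* Rings without unit are represented as subrings, not assumed to contain 1,
   of an ambient ring with 1.  Ideals, primeness and simplicity of such a
   subring A are internal to A and do not involve the ambient ring. *)

Definition subring (Q : nzRingType) (A : set Q) : Prop :=
  [/\ A 0, forall x y, A x -> A y -> A (x - y)
    & forall x y, A x -> A y -> A (x * y)].

Definition ideal (Q : nzRingType) (A I : set Q) : Prop :=
  [/\ I `<=` A, I 0, forall x y, I x -> I y -> I (x - y)
    & forall a x, A a -> I x -> I (a * x) /\ I (x * a)].

Definition ideal_product (Q : nzRingType) (I J : set Q) : set Q :=
  [set x | exists (n : nat) (a b : 'I_n -> Q),
     [/\ forall i, I (a i), forall i, J (b i) & x = \sum_i a i * b i]].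

Definition prime_ring (Q : nzRingType) (A : set Q) : Prop :=
  [/\ subring A, A <> [set 0]
    & forall I J, ideal A I -> ideal A J -> I <> [set 0] -> J <> [set 0] ->
        ideal_product I J <> [set 0]].

Definition center (Q : nzRingType) (A : set Q) : set Q :=
  [set z | A z /\ forall x, A x -> z * x = x * z].

(* Homomorphisms I -> R of right (left) R-modules are represented by total
   functions, of which only the values on I matter. *)

Definition right_module_hom (Q : nzRingType) (R I : set Q) (f : Q -> Q) : Prop :=
  [/\ forall x, I x -> R (f x),
      forall x y, I x -> I y -> f (x + y) = f x + f y
    & forall x r, I x -> R r -> f (x * r) = f x * r].

Definition left_module_hom (Q : nzRingType) (R I : set Q) (g : Q -> Q) : Prop :=
  [/\ forall x, I x -> R (g x),
      forall x y, I x -> I y -> g (x + y) = g x + g y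
    & forall r x, R r -> I x -> g (r * x) = r * g x].

(* Q is (a model of) the symmetric Martindale ring of quotients of R; these
   properties determine Q up to isomorphism over R. *)
Record symmetric_martindale (Q : nzRingType) (R : set Q) : Prop := {
  martindale_subring : subring R;
  martindale_denominator : forall q : Q, exists I,
    [/\ ideal R I, I <> [set 0]
      & [set q * x | x in I] `|` [set x * q | x in I] `<=` R];
  martindale_faithful : forall (I : set Q) (q : Q),
    ideal R I -> I <> [set 0] -> q != 0 ->
    [set q * x | x in I] <> [set 0] /\ [set x * q | x in I] <> [set 0];
  martindale_balanced : forall (I : set Q) (f g : Q -> Q),
    ideal R I -> I <> [set 0] ->
    right_module_hom R I f -> left_module_hom R I g ->
    (forall x y, I x -> I y -> x * f y = g x * y) ->
    exists q : Q, forall x y, I x -> I y -> f y = q * y /\ g x = x * q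
}.

Definition scalars (C : fieldType) (Q : algType C) : set Q :=
  [set c%:A | c in [set: C]].
Arguments scalars {C} Q.

(* The field C, embedded in Q by c |-> c%:A, is the center of Q. *)
Definition is_extended_centroid (C : fieldType) (Q : algType C) (R : set Q) : Prop :=
  symmetric_martindale R /\ center [set: Q] = scalars Q.

Definition central_closure (C : fieldType) (Q : algType C) (R : set Q) : set Q :=
  [set x | exists (n : nat) (l : 'I_n -> C) (r : 'I_n -> Q),
     (forall i, R (r i)) /\ x = \sum_i l i *: r i].

(* The free unital algebra on 'X_0, 'X_1, ...: the monoid algebra of the free
   monoid of words over nat. *)
Definition free_algebra (C : fieldType) := {malg C[{fmonom nat}]}.

(* The indeterminate of index i is sent to r i. *)
Definition free_eval (C : fieldType) (Q : algType C) (r : nat -> Q)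
    (f : free_algebra C) : Q :=
  mmap (in_alg Q) (fun w : {fmonom nat} => \prod_(i <- w) r i) f.

(* Quantifying over sequences of elements of R is harmless: f only involves
   finitely many indeterminates. *)
Definition identity_of (C : fieldType) (Q : algType C) (R : set Q)
    (f : free_algebra C) : Prop :=
  forall r : nat -> Q, (forall i, R (r i)) -> free_eval r f = 0.

Definition PI_ring (C : fieldType) (Q : algType C) (R : set Q) : Prop :=
  exists f : free_algebra C, f != 0 /\ identity_of R f.

Definition unital_subalgebra (C : fieldType) (Q : algType C) (A : set Q) : Prop :=
  [/\ subring A, forall (c : C) x, A x -> A (c *: x) & A 1].

Definition simple_ring (Q : nzRingType) (A : set Q) : Prop :=
  A <> [set 0] /\ forall I, ideal A I -> I = [set 0] \/ I = A.

Definition central_simple (C : fieldType) (Q : algType C) (A : set Q) : Prop :=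
  [/\ unital_subalgebra A, simple_ring A & center A = scalars Q].

Definition finite_dimensional (C : fieldType) (Q : algType C) (A : set Q) : Prop :=
  exists (n : nat) (b : 'I_n -> Q), (forall i, A (b i)) /\
    forall x, A x -> exists! c : {ffun 'I_n -> C}, x = \sum_i c i *: b i.

Definition field_of_fractions (C : fieldType) (S : set C) : Prop :=
  subring S /\
  forall c : C, exists a b, [/\ S a, S b, b != 0 & c = a / b].

(* Main.v *)
Require Import Defs.
From mathcomp Require Import all_boot all_algebra finmap.
From mathcomp Require Import boolp classical_sets.
From mathcomp.multinomials Require Import monalg.

(** Everything rests on one property of the extended centroid: elements of Q
that are linearly independent over C are separated by two-sided
multiplications x |-> \sum_i a_i x b_i with coefficients in R
([two_sided_separates]). If some a outside the span of b_1, ..., b_k were not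
separated from them, then phi(b_k) |-> phi(a), for phi killing b_1, ...,
b_(k-1), would be a well-defined bimodule map between ideals of R. By the
universal property of Q it is multiplication by an element of Q, which is
central, hence a scalar c, and induction puts a - c b_k in the span of the
other b_j. Consequently a two-sided multiplication that vanishes on a nonzero
ideal vanishes on Q ([two_sided_eq0]).

Linearizing a monomial of maximal degree turns the given identity into a
multilinear one ([multilinearize]). Suppose that every nonzero two-sided
multiplication had infinite rank on R. An argument of Amitsur
([simultaneously_independent]) then allows one to choose values of the
indeterminates in R one after the other, so that more and more words in them
stay linearly independent; every multilinear monomial is eventually among
them, which is absurd. So some nonzero two-sided multiplication has finite
rank, and separation shrinks it to one of the form x |-> c x c with c in R
nonzero ([corner_fin_dim]). If c R were infinite-dimensional, annihilators in
it would provide y_0, ..., y_(n-1) in R with y_j y_i = 0 for i <= j but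
y_0 ... y_(n-1) nonzero ([staircase]), and a multilinear identity would reduce
to its single term y_0 ... y_(n-1). Hence c R is finite-dimensional, and so is
R, because an element of R is determined by its action on c R
([identity_fin_dim]).

Now let I be a nonzero ideal of R. Its span is finite-dimensional; an element
q of Q outside it would be separated from it by a two-sided multiplication
that kills I but not q, which is impossible. So every nonzero ideal of R spans
Q ([ideal_spans]). This makes Q the central closure and a simple ring. A
two-sided multiplication on Q with values in C, multiplied by enough
denominators, maps part of I into I with a nonzero value, which lies in the
center of R ([ideal_meets_center]). Applied to the ideal of denominators of an
element of Q, this yields central denominators. *)

Set Implicit Arguments.
Unset Strict Implicit.
Unset Printing Implicit Defensive.

Import GRing.Theory.

Local Open Scope classical_set_scope.
Local Open Scope ring_scope.

(** * Linear algebra without dimensions *)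

Section LinearAlgebra.

Context (C : fieldType).

(** Recursion on the list makes each vector relative to the span of the later
ones available directly, which is how spans are used in the inductions
below. *)
Fixpoint lin_span (V : lmodType C) (s : seq V) : set V :=
  if s is b :: s' then [set x | exists c : C, lin_span s' (x - c *: b)]
  else [set 0].

Fixpoint lin_free (V : lmodType C) (s : seq V) : Prop :=
  if s is b :: s' then ~ lin_span s' b /\ lin_free s' else True.

Definition subspace (V : lmodType C) (U : set V) : Prop :=
  U 0 /\ forall (c : C) x y, U x -> U y -> U (c *: x + y).

Definition fin_dim (V : lmodType C) (U : set V) : Prop :=
  exists s, U `<=` lin_span s.

Section Subspaces.

Context (V : lmodType C).
Implicit Types (U S : set V) (s t : seq V).

Lemma subspaceD U x y : subspace U -> U x -> U y -> U (x + y).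
Proof. by move=> [_ UD] Ux Uy; rewrite -[x]scale1r; apply: UD. Qed.

Lemma subspaceZ U c x : subspace U -> U x -> U (c *: x).
Proof. by move=> [U0 UD] Ux; rewrite -[_ *: _]addr0; apply: UD. Qed.

Lemma subspaceB U x y : subspace U -> U x -> U y -> U (x - y).
Proof.
move=> subU Ux Uy; rewrite -scaleN1r; apply: subspaceD => //.
exact: subspaceZ.
Qed.

Lemma subspace_sum U (I : eqType) (r : seq I) (F : I -> V) :
  subspace U -> (forall i, i \in r -> U (F i)) -> U (\sum_(i <- r) F i).
Proof.
move=> subU UF; rewrite big_seq; elim/big_rec: _ => [|i x ri Ux].
  by case: subU.
by apply: subspaceD => //; apply: UF.
Qed.

Lemma lin_span_subspace s : subspace (lin_span s).
Proof.
elim: s => [|b s IH]; first by split=> //= c x y -> ->; rewrite scaler0 addr0.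
split=> [|c x y] /=; first by exists 0; rewrite scale0r subr0; case: IH.
move=> [d sd] [e se]; exists (c * d + e).
rewrite scalerDl -scalerA opprD addrACA -scalerBr.
by case: IH => _; apply.
Qed.

Lemma lin_span_mem s b : b \in s -> lin_span s b.
Proof.
elim: s => //= a s IH; rewrite inE => /predU1P[->|/IH sb].
  by exists 1; rewrite scale1r subrr; case: (lin_span_subspace s).
by exists 0; rewrite scale0r subr0.
Qed.

Lemma lin_span_min U s :
  subspace U -> (forall b, b \in s -> U b) -> lin_span s `<=` U.
Proof.
move=> subU; elim: s => [_ x /= ->|b s IH Us x [c sx]]; first by case: subU.
rewrite -[x](subrK (c *: b)); apply: subspaceD => //.
  by apply: IH sx => d ds; apply: Us; rewrite inE ds orbT.
by apply: subspaceZ => //; apply: Us; rewrite inE eqxx.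
Qed.

Lemma lin_span_sub s t : {subset s <= t} -> lin_span s `<=` lin_span t.
Proof.
move=> st; apply: lin_span_min => [|b /st]; first exact: lin_span_subspace.
exact: lin_span_mem.
Qed.

Lemma lin_span_ord s x :
  lin_span s x <-> exists c : 'I_(size s) -> C, x = \sum_i c i *: s`_i.
Proof.
elim: s x => [|b s IH] x /=.
  by split=> [->|[c ->]]; [exists (fun=> 0)|]; rewrite big_ord0.
split=> [[c /IH [d xE]]|[c ->]].
  exists (fun i => if unlift ord0 i is Some j then d j else c).
  rewrite big_ord_recl unlift_none /= -[x](subrK (c *: b)) xE addrC.
  by congr (_ + _); apply: eq_bigr => i _; rewrite liftK.
exists (c ord0); rewrite big_ord_recl /= addrAC subrr add0r.
by apply/IH; exists (fun i => c (lift ord0 i)).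
Qed.

Lemma lin_free_exists s :
  exists t, lin_free t /\ lin_span s `<=` lin_span t.
Proof.
elim: s => [|b s [t [ft st]]]; first by exists [::]; split.
have [tb|ntb] := pselect (lin_span t b); last first.
  by exists (b :: t); split=> //= x [c sx]; exists c; apply: st.
exists t; split=> // x [c /st sx]; rewrite -[x](subrK (c *: b)).
apply: (subspaceD (lin_span_subspace t)) => //.
exact: (subspaceZ _ (lin_span_subspace t)).
Qed.

Lemma lin_free_coef0 s (c : 'I_(size s) -> C) :
  lin_free s -> \sum_i c i *: s`_i = 0 -> forall i, c i = 0.
Proof.
elim: s c => [|b s IH] c /= => [_ _ []//|[nsb fs]].
rewrite big_ord_recl => sum0.
have sumS : lin_span s (\sum_(i < size s) c (lift ord0 i) *: s`_i).
  by apply/lin_span_ord; exists (fun i => c (lift ord0 i)).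
have c0 : c ord0 = 0.
  apply: contrapT => /eqP c0; apply: nsb.
  rewrite -[b](scalerK c0); apply: (subspaceZ _ (lin_span_subspace s)).
  move/addr0_eq: sum0 => sum0.
  rewrite -[_ *: b]opprK sum0 -scaleN1r.
  exact: (subspaceZ _ (lin_span_subspace s)).
move: sum0; rewrite c0 scale0r add0r => /(IH (c \o lift ord0) fs) cS i.
by have [j ->|->//] := unliftP ord0 i; apply: cS.
Qed.

Lemma fin_dim_sub U S : U `<=` S -> fin_dim S -> fin_dim U.
Proof. by move=> US [s Ss]; exists s; apply: subset_trans Ss. Qed.

Lemma nonzero_of_infinite U : ~ fin_dim U -> exists2 u, U u & u != 0.
Proof.
move=> infU; apply: contrapT => noU; apply: infU; exists [::] => u Uu /=.
by apply: contrapT => /eqP u0; apply: noU; exists u.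
Qed.

End Subspaces.

Section LinearMaps.

Context (V W : lmodType C).

Lemma linear_map0 (h : V -> W) : linear h -> h 0 = 0.
Proof.
by move=> hlin; have := hlin (-1) 0 0; rewrite scaler0 addr0 scaleN1r addNr.
Qed.

Lemma linear_mapD (h : V -> W) : linear h -> {morph h : x y / x + y}.
Proof. by move=> hlin x y; have := hlin 1 x y; rewrite !scale1r. Qed.

Lemma linear_mapZ (h : V -> W) (c : C) x : linear h -> h (c *: x) = c *: h x.
Proof.
by move=> hlin; have := hlin c x 0; rewrite (linear_map0 hlin) !addr0.
Qed.

Lemma lin_span_map (h : V -> W) s x :
  linear h -> lin_span s x -> lin_span (map h s) (h x).
Proof.
move=> hlin; elim: s x => [|b s IH] x /=.
  by move=> ->; apply: linear_map0.
move=> [c /IH sx]; exists c.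
rewrite -[x](subrK (c *: b)) (linear_mapD hlin) (linear_mapZ c b hlin).
by rewrite addrK.
Qed.

Lemma fin_dim_image (h : V -> W) (U : set V) :
  linear h -> fin_dim U -> fin_dim (h @` U).
Proof.
move=> hlin [s Us]; exists (map h s) => _ [u /Us su <-].
exact: lin_span_map.
Qed.

(** Rank and nullity in one statement: modulo the kernel of h, a subspace U
whose image is finite-dimensional is spanned by finitely many of its own
elements. The case h = id gives bases inside U. *)
Lemma lift_image_basis (h : V -> W) (U : set V) s :
    linear h -> subspace U -> (forall u, U u -> lin_span s (h u)) ->
  exists t, (forall u, u \in t -> U u) /\
    forall u, U u -> exists2 w, lin_span t w & h u = h w.
Proof.
move=> hlin; elim: s U => [|b s IH] U subU Us.
  exists [::]; split=> // u /Us /= hu0; exists 0 => //.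
  by rewrite hu0 linear_map0.
have subU' : subspace (U `&` [set u | lin_span s (h u)]).
  case: subU (lin_span_subspace s) => U0 UD [s0 sD].
  split=> [|c x y [Ux sx] [Uy sy]]; split=> //=; first by rewrite linear_map0.
    exact: UD.
  by rewrite hlin; apply: sD.
have [|t [tU' Ut]] := IH _ subU'; first by move=> u [].
(* If u0 has a nonzero coefficient along b, subtracting multiples of u0 moves
   every u into the part of U that maps to the span of s. *)
have [sU|/existsNP[u0 /not_implyP[Uu0 nsu0]]] :=
    pselect (forall u, U u -> lin_span s (h u)).
  exists t; split=> [u /tU' []//|u Uu].
  by apply: Ut; split=> //; apply: sU.
have [c0 sc0] := Us _ Uu0.
have c0N : c0 != 0.
  by apply/eqP => c00; apply: nsu0; rewrite c00 scale0r subr0 in sc0.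
exists (u0 :: t); split=> [u|u Uu].
  by rewrite inE => /predU1P[->//|/tU' []].
have [c sc] := Us _ Uu.
have [|w tw hw] := Ut (u - (c / c0) *: u0).
  split; first by apply: subspaceB => //; apply: subspaceZ.
  rewrite /= -scaleN1r addrC hlin (linear_mapZ _ _ hlin) scaleN1r addrC /=.
  have -> : h u - (c / c0) *: h u0 =
            (h u - c *: b) - (c / c0) *: (h u0 - c0 *: b).
    by rewrite scalerBr scalerA divfK // opprB addrA subrK.
  apply: (subspaceB (lin_span_subspace s)) => //.
  exact: (subspaceZ _ (lin_span_subspace s)).
exists ((c / c0) *: u0 + w).
  by exists (c / c0); rewrite addrAC subrr add0r.
by rewrite (linear_mapD hlin) -hw -(linear_mapD hlin) addrC subrK.
Qed.

End LinearMaps.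

Lemma basis_in_subspace (V : lmodType C) (U : set V) :
    subspace U -> fin_dim U ->
  exists t, (forall u, u \in t -> U u) /\ U `<=` lin_span t.
Proof.
move=> subU [s Us].
have [//|t [tU Ut]] := @lift_image_basis _ _ id U s _ subU Us.
by exists t; split=> // u /Ut [w tw ->].
Qed.

(** Passing to the kernel of a map with finite-dimensional image removes only
finitely many dimensions, so infinite dimension survives finitely many such
steps. *)
Lemma infinite_common_kernel (V W : lmodType C) (I : eqType) (r : seq I)
    (h : I -> V -> W) (U : set V) :
    (forall i, linear (h i)) -> subspace U -> ~ fin_dim U ->
    (forall i, i \in r -> fin_dim (h i @` U)) ->
  ~ fin_dim (U `&` [set u | forall i, i \in r -> h i u = 0]).
Proof.
move=> hlin; elim: r U => [|i r IH] U subU infU finh.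
  by move=> finU; apply: infU; apply: fin_dim_sub finU => u.
have subK : subspace (U `&` [set u | h i u = 0]).
  case: subU => U0 UD; split=> [|c x y [Ux hx] [Uy hy]]; split=> //=.
  - exact: linear_map0.
  - exact: UD.
  - by rewrite hlin hx hy scaler0 addr0.
have infK : ~ fin_dim (U `&` [set u | h i u = 0]).
  move=> [k Kk]; have [s hs] := finh _ (mem_head _ _).
  have [|t [tU Ut]] := lift_image_basis (s := s) (hlin i) subU.
    by move=> u Uu; apply: hs; exists u.
  apply: infU; exists (t ++ k) => u Uu; have [w tw hw] := Ut _ Uu.
  rewrite -[u](subrK w); apply: (subspaceD (lin_span_subspace _)).
    apply: (@lin_span_sub _ k) => [x|]; first by rewrite mem_cat orbC => ->.
    apply: Kk; split; last first.
      by rewrite /= -scaleN1r addrC hlin hw scaleN1r addNr.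
    by apply: subspaceB => //; apply: lin_span_min tw.
  by apply: lin_span_sub tw => x; rewrite mem_cat => ->.
apply: contra_not (IH _ subK infK _) => [|j rj]; last first.
  apply: fin_dim_sub (finh j _); last by rewrite inE rj orbT.
  by move=> _ [u [Uu _] <-]; exists u.
apply: fin_dim_sub => u [[Uu hu] ru]; split=> // j.
by rewrite inE => /predU1P[->|/ru].
Qed.

Section Independence.

Context (V : lmodType C) (I : eqType).
Implicit Types (S : set V) (r : seq I) (b : I -> V).

(** Independence modulo S. Families are indexed by duplicate-free lists, so
that coefficients can be functions on the index type. *)
Definition independent S r b : Prop :=
  forall c : I -> C, S (\sum_(i <- r) c i *: b i) ->
    forall i, i \in r -> c i = 0.

(** The sum of S and of the span of the family. *)
Definition thicken S r b : set V :=
  [set v | exists e : I -> C, S (v - \sum_(i <- r) e i *: b i)].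

Lemma sub_thicken S r b : S `<=` thicken S r b.
Proof.
move=> v Sv; exists (fun=> 0); rewrite big1 ?subr0 // => i _.
exact: scale0r.
Qed.

Lemma thicken_subspace S r b : subspace S -> subspace (thicken S r b).
Proof.
move=> [S0 SD]; split=> [|c x y [d Sx] [e Sy]]; first exact: sub_thicken.
exists (fun i => c * d i + e i).
under eq_bigr do rewrite scalerDl -scalerA.
by rewrite big_split -scaler_sumr opprD addrACA -scalerBr; apply: SD.
Qed.

Lemma thicken_fin_dim S r b : fin_dim S -> fin_dim (thicken S r b).
Proof.
move=> [s Ss]; exists (map b r ++ s) => v [e /Ss sv].
rewrite -[v](subrK (\sum_(i <- r) e i *: b i)).
have subT := lin_span_subspace (map b r ++ s).
apply: subspaceD => //.
  by apply: lin_span_sub sv => x; rewrite mem_cat orbC => ->.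
apply: subspace_sum => // i ri; apply: subspaceZ => //.
by apply: lin_span_mem; rewrite mem_cat map_f.
Qed.

Lemma independent_sub S S' r b :
  S `<=` S' -> independent S' r b -> independent S r b.
Proof. by move=> SS' ind c /SS'; apply: ind. Qed.

Definition extend_coef (i : I) (a : C) (c : I -> C) : I -> C :=
  fun j => if j == i then a else c j.

Lemma sum_extend_coef i a (c : I -> C) r b : i \notin r ->
  \sum_(j <- i :: r) extend_coef i a c j *: b j =
  a *: b i + \sum_(j <- r) c j *: b j.
Proof.
move=> nri; rewrite big_cons /extend_coef eqxx; congr (_ + _).
apply: eq_big_seq => j rj.
by case: eqP rj nri => // -> ->.
Qed.

Lemma independent_cons S i r b : subspace S ->
    independent S r b -> (forall c, ~ S (b i - \sum_(j <- r) c j *: b j)) ->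
  independent S (i :: r) b.
Proof.
move=> subS ind nS c; rewrite big_cons => Sc.
have ci : c i = 0.
  apply: contrapT => /eqP ci; apply: (nS (fun j => - ((c i)^-1 * c j))).
  rewrite -sumrN; under eq_bigr do rewrite scaleNr opprK -scalerA.
  rewrite -scaler_sumr -[b i](scalerK ci) -scalerDr.
  exact: subspaceZ.
move: Sc; rewrite ci scale0r add0r => /ind cr j.
by rewrite inE => /predU1P[->|/cr].
Qed.

End Independence.

Section Amitsur.

Context (V W : lmodType C) (I : eqType) (P : set V) (T : I -> V -> W).
Hypothesis P0 : P 0.
Hypothesis PD : forall x y, P x -> P y -> P (x + y).
Hypothesis TD : forall i x y, T i (x + y) = T i x + T i y.

Definition finite_rank_comb (r : seq I) (c : I -> C) : Prop :=
  fin_dim [set \sum_(i <- r) c i *: T i x | x in P].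

(** Amitsur's lemma, over an arbitrary field. Adding one map T_i to a family
already independent at some points, suppose that T_i x always depends on the
other values. Correct T_i by the combination c0 that works at one such point
x0, so that the corrected map T' sends x0 into S. At a point y independent
even of the values at x0, comparing the dependences at x0, y and x0 + y forces
T' y into S. Every z is a difference of two such points, so T' has finite
rank. *)
Lemma simultaneously_independent (r : seq I) : uniq r ->
    (forall c, finite_rank_comb r c -> forall i, i \in r -> c i = 0) ->
  forall S : set W, subspace S -> fin_dim S ->
  exists2 x, P x & independent S r (T^~ x).
Proof.
elim: r => [|i r IH] /=.
  by move=> _ _ S _ _; exists 0 => // c _ i; rewrite in_nil.
move=> /andP[nri ur] norank S subS finS.
have {}IH := IH ur _.
have norank' c : finite_rank_comb r c -> forall j, j \in r -> c j = 0.
  move=> frc j rj; have := norank (extend_coef i 0 c) _ j.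
  rewrite inE rj orbT /extend_coef.
  case: eqP rj (nri) => [->->//|_ rj _]; apply=> //.
  move: frc; apply: fin_dim_sub => _ [x Px <-]; exists x => //.
  by rewrite sum_extend_coef // scale0r add0r.
have {}IH := IH norank'.
apply: contrapT => noind.
have dep x : P x -> independent S r (T^~ x) ->
    exists c, S (T i x - \sum_(j <- r) c j *: T j x).
  move=> Px indx; apply: contrapT => noc; apply: noind; exists x => //.
  by apply: independent_cons => // c Sc; apply: noc; exists c.
have [x0 Px0 ind0] := IH _ subS finS.
have [c0 Sc0] := dep _ Px0 ind0.
(* The combinations of the other maps, additive in both arguments. *)
pose L c x := \sum_(j <- r) c j *: T j x.
have LD c x y : L c (x + y) = L c x + L c y.
  by rewrite -big_split; apply: eq_bigr => j _; rewrite TD scalerDr.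
have LB c d x : L (fun j => c j - d j) x = L c x - L d x.
  by rewrite -sumrB; apply: eq_bigr => j _; rewrite scalerBl.
pose T' x := T i x - L c0 x.
have T'D x y : T' (x + y) = T' x + T' y.
  by rewrite /T' TD LD opprD addrACA.
pose S1 := thicken S r (T^~ x0).
have subS1 : subspace S1 by exact: thicken_subspace.
have finS1 : fin_dim S1 by exact: thicken_fin_dim.
have key y : P y -> independent S1 r (T^~ y) -> S (T' y).
  move=> Py ind1.
  have [d Sd] := dep _ Py (independent_sub (@sub_thicken _ _ _ _ _) ind1).
  have [|e Se] := dep _ (PD Px0 Py).
    move=> c Sc; apply: ind1; exists (fun j => - c j); congr (S _): Sc.
    rewrite -sumrN -big_split /=.
    by apply: eq_bigr => j _; rewrite TD scalerDr addrC scaleNr opprK.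
  have zid (u v p q a w : W) :
      u + v - (p + q) - (u - a) - (v - w) = (a - p) + (w - q).
    rewrite (opprD p) (addrACA u) -(addrA (u - p + (v - q)))
            (addrACA (u - p)) !opprB.
    by congr (_ + _); rewrite addrC addrA subrK.
  have Sde : S (L (fun j => c0 j - e j) x0 + L (fun j => d j - e j) y).
    rewrite !LB -(zid (T i x0) (T i y)) -TD -LD.
    by apply: subspaceB => //; apply: subspaceB.
  have de j : j \in r -> d j = e j.
    move=> rj; apply/subr0_eq; move: j rj; apply: ind1.
    exists (fun j => - (c0 j - e j)); rewrite -sumrN.
    under [X in _ + X]eq_bigr do rewrite scaleNr opprK.
    by rewrite addrC.
  have Ld : L (fun j => d j - e j) y = 0.
    by rewrite /L big_seq big1 // => j /de ->; rewrite subrr scale0r.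
  rewrite Ld addr0 in Sde.
  congr S: Sd; congr (_ - _); apply: eq_big_seq => j rj.
  by rewrite (de _ rj); congr (_ *: _); apply/esym/subr0_eq/(ind0 _ Sde).
have T'S z : P z -> S (T' z).
  move=> Pz; pose S2 := thicken S1 r (T^~ z).
  have [y Py ind2] : exists2 y, P y & independent S2 r (T^~ y).
    by apply: IH; [exact: thicken_subspace | exact: thicken_fin_dim].
  have Sy : S (T' y).
    by apply: key => //; apply: independent_sub ind2; apply: sub_thicken.
  rewrite -[T' z](addrK (T' y)) -T'D; apply: subspaceB => //.
  apply: key; first exact: PD.
  move=> c S1c; apply: ind2; exists (fun j => - c j); congr (S1 _): S1c.
  rewrite -sumrN -big_split /=.
  by apply: eq_bigr => j _; rewrite TD scalerDr addrC scaleNr opprK.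
suff /norank/(_ i (mem_head _ _))/eqP :
    finite_rank_comb (i :: r) (extend_coef i 1 (fun j => - c0 j)).
  by rewrite /extend_coef eqxx oner_eq0.
apply: fin_dim_sub finS => _ [x Px <-]; rewrite sum_extend_coef // scale1r.
by under eq_bigr do rewrite scaleNr; rewrite sumrN; apply: T'S.
Qed.

End Amitsur.
End LinearAlgebra.

Section LinearSpan.

Context (C : fieldType) (V : lmodType C).
Implicit Types (S U : set V).

Definition span_of S : set V :=
  [set x | exists2 s, forall b, b \in s -> S b & lin_span s x].

Lemma span_of_subspace S : subspace (span_of S).
Proof.
split=> [|c x y [s Ss sx] [t St ty]]; first by exists [::].
exists (s ++ t) => [b|]; first by rewrite mem_cat => /orP[/Ss|/St].
have subT := lin_span_subspace (s ++ t).
apply: subspaceD => //; [apply: subspaceZ => // |].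
  by apply: lin_span_sub sx => b; rewrite mem_cat => ->.
by apply: lin_span_sub ty => b; rewrite mem_cat orbC => ->.
Qed.

Lemma sub_span_of S : S `<=` span_of S.
Proof.
move=> x Sx; exists [:: x] => [b|]; first by rewrite inE => /eqP ->.
by apply: lin_span_mem; rewrite mem_head.
Qed.

Lemma span_of_min S U : subspace U -> S `<=` U -> span_of S `<=` U.
Proof. by move=> subU SU x [s Ss]; apply: lin_span_min => // b /Ss/SU. Qed.

Lemma span_of_fin_dim S : fin_dim S -> fin_dim (span_of S).
Proof.
move=> [s Ss]; exists s; apply: span_of_min Ss.
exact: lin_span_subspace.
Qed.

Lemma lin_span_family (I : eqType) (r : seq I) (b : I -> V) x : uniq r ->
  lin_span (map b r) x -> exists e, x = \sum_(i <- r) e i *: b i.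
Proof.
elim: r x => [|i r IH] x /=.
  by move=> _ ->; exists (fun=> 0); rewrite big_nil.
move=> /andP[nri ur] [c /(IH _ ur)[e xE]]; exists (extend_coef i c e).
by rewrite sum_extend_coef // -xE addrC subrK.
Qed.

End LinearSpan.

(** * Two-sided multiplications and the extended centroid *)

Section TwoSided.

Context (C : fieldType) (Q : algType C).
Implicit Types (s t : seq (Q * Q)) (S : set Q).

Definition two_sided s (x : Q) : Q := \sum_(p <- s) p.1 * x * p.2.

Definition coefs_in S s : Prop := forall p, p \in s -> S p.1 /\ S p.2.

Definition lscale (a : Q) s := [seq (a * p.1, p.2) | p <- s].

Definition rscale s (a : Q) := [seq (p.1, p.2 * a) | p <- s].

Lemma two_sided_linear s : linear (two_sided s).
Proof.
move=> c x y; rewrite /two_sided scaler_sumr -big_split /=.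
by apply: eq_bigr => p _; rewrite mulrDr mulrDl -scalerAr -scalerAl.
Qed.

Lemma two_sided_cons p s x :
  two_sided (p :: s) x = p.1 * x * p.2 + two_sided s x.
Proof. exact: big_cons. Qed.

Lemma two_sided_cat s t x :
  two_sided (s ++ t) x = two_sided s x + two_sided t x.
Proof. exact: big_cat. Qed.

Lemma two_sided_lscale a s x : two_sided (lscale a s) x = a * two_sided s x.
Proof.
rewrite /two_sided big_map mulr_sumr.
by apply: eq_bigr => p _ /=; rewrite !mulrA.
Qed.

Lemma two_sided_rscale a s x : two_sided (rscale s a) x = two_sided s x * a.
Proof.
rewrite /two_sided big_map mulr_suml.
by apply: eq_bigr => p _ /=; rewrite !mulrA.
Qed.

Lemma coefs_in_cat S s t :
  coefs_in S s -> coefs_in S t -> coefs_in S (s ++ t).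
Proof. by move=> Ss St p; rewrite mem_cat => /orP[/Ss|/St]. Qed.

Lemma coefs_in_lscale S a s :
  (forall x, S x -> S (a * x)) -> coefs_in S s -> coefs_in S (lscale a s).
Proof. by move=> Sa Ss _ /mapP[p /Ss[S1 S2] ->]; split=> //; apply: Sa. Qed.

Lemma coefs_in_rscale S a s :
  (forall x, S x -> S (x * a)) -> coefs_in S s -> coefs_in S (rscale s a).
Proof. by move=> Sa Ss _ /mapP[p /Ss[S1 S2] ->]; split=> //; apply: Sa. Qed.

Lemma two_sided_span s bs x : (forall b, b \in bs -> two_sided s b = 0) ->
  lin_span bs x -> two_sided s x = 0.
Proof.
move=> sbs; apply: (@lin_span_min _ _ [set x | two_sided s x = 0]) => //.
split=> [|c y z /= sy sz]; first exact/linear_map0/two_sided_linear.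
by rewrite two_sided_linear sy sz scaler0 addr0.
Qed.

(** A right coefficient that depends on the others can be distributed over
them, which saves a term. *)
Lemma two_sided_absorb a b s : lin_span [seq p.2 | p <- s] b ->
  exists t, size t = size s /\
    forall x, two_sided ((a, b) :: s) x = two_sided t x.
Proof.
elim: s a b => [|[a' b'] s IH] a b /=.
  move=> ->; exists [::]; split=> // x.
  by rewrite two_sided_cons /= mulr0 add0r.
move=> [c /(IH a)[t [szt Et]]]; exists ((a' + c *: a, b') :: t).
split=> [|x]; first by rewrite /= szt.
rewrite [RHS]two_sided_cons -Et !two_sided_cons /= !addrA; congr (_ + _).
rewrite !mulrDl -!scalerAl mulrBr -scalerAr [RHS]addrC.
by rewrite -addrA [- _ + _]addrC addrK addrC.
Qed.

End TwoSided.

Lemma nonzero_setP (Q : nzRingType) (I : set Q) : I 0 ->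
  I <> [set 0] <-> exists2 x, I x & x != 0.
Proof.
move=> I0; split=> [IN|[x Ix x0] IE]; last first.
  by rewrite IE /= in Ix; rewrite Ix eqxx in x0.
apply: contrapT => noI; apply: IN; apply/seteqP; split=> [x Ix|x ->//] /=.
by apply: contrapT => /eqP x0; apply: noI; exists x.
Qed.

Lemma add_closed (V : zmodType) (A : set V) :
    A 0 -> (forall x y, A x -> A y -> A (x - y)) ->
  forall x y, A x -> A y -> A (x + y).
Proof.
move=> A0 AB x y Ax Ay; rewrite -[y]opprK; apply: (AB x (- y)) => //.
by rewrite -sub0r; apply: AB.
Qed.

Definition nonzero_ideal (Q : nzRingType) (R I : set Q) : Prop :=
  ideal R I /\ exists2 x, I x & x != 0.

Section Martindale.

Context (C : fieldType) (Q : algType C) (R : set Q).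
Hypothesis primeR : prime_ring R.
Hypothesis quotR : symmetric_martindale R.
Hypothesis centerQ : center [set: Q] = scalars Q.
Implicit Types (I J : set Q).

Lemma prime_ring0 : R 0. Proof. by case: primeR => -[]. Qed.

Lemma prime_ringB x y : R x -> R y -> R (x - y).
Proof. by case: primeR => -[_ + _] _ _; apply. Qed.

Lemma prime_ringN x : R x -> R (- x).
Proof. by rewrite -sub0r; apply: prime_ringB; apply: prime_ring0. Qed.

Lemma prime_ringD x y : R x -> R y -> R (x + y).
Proof. exact: (add_closed prime_ring0 prime_ringB). Qed.

Lemma prime_ringM x y : R x -> R y -> R (x * y).
Proof. by case: primeR => -[_ _ +] _ _; apply. Qed.

Lemma nonzero_ideal_neq I : nonzero_ideal R I <-> ideal R I /\ I <> [set 0].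
Proof.
by split=> -[idI]; have [_ I0 _ _] := idI; move=> /(nonzero_setP I0).
Qed.

Lemma nonzero_ideal_self : nonzero_ideal R R.
Proof.
apply/nonzero_ideal_neq; case: primeR => subR RN0 _; split=> //.
split=> //; [exact: prime_ring0 | exact: prime_ringB |].
by move=> a x Ra Rx; split; apply: prime_ringM.
Qed.

Lemma nonzero_idealI I J :
  nonzero_ideal R I -> nonzero_ideal R J -> nonzero_ideal R (I `&` J).
Proof.
move=> /nonzero_ideal_neq[idI IN] /nonzero_ideal_neq[idJ JN].
have [_ _ /(_ I J idI idJ IN JN) IJN] := primeR.
have [IR I0 IB IM] := idI; have [JR J0 JB JM] := idJ.
split.
  split=> [x [/IR]||x y [Ix Jx] [Iy Jy]|a x Ra [Ix Jx]] //.
    by split; [apply: IB | apply: JB].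
  by have [? ?] := IM _ _ Ra Ix; have [? ?] := JM _ _ Ra Jx.
have IJ0 : ideal_product I J 0.
  by exists 0%N, (fun=> 0), (fun=> 0); split=> [[]|[]|] //; rewrite big_ord0.
have [x [n [a [b [Ia Jb ->]]]] xN] := (nonzero_setP IJ0).1 IJN.
apply: contrapT => noIJ; case/eqP: xN; apply: big1 => i _.
apply: contrapT => /eqP abN; apply: noIJ; exists (a i * b i) => //; split.
  by apply: (IM (b i) (a i) _ _).2 => //; apply: JR.
by apply: (JM (a i) (b i) _ _).1 => //; apply: IR.
Qed.

Lemma denominators (qs : seq Q) : exists I, nonzero_ideal R I /\
  forall q, q \in qs -> forall x, I x -> R (q * x) /\ R (x * q).
Proof.
elim: qs => [|q qs [I [idI Iqs]]].
  by exists R; split; first exact: nonzero_ideal_self.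
have [J [idJ JN Jq]] := martindale_denominator quotR q.
exists (I `&` J); split.
  by apply: nonzero_idealI => //; apply/nonzero_ideal_neq.
move=> p; rewrite inE => /predU1P[->|/Iqs Ip] x [Ix Jx]; last exact: Ip.
by split; apply: Jq; [left | right]; exists x.
Qed.

Lemma denominator q : exists I, nonzero_ideal R I /\
  forall x, I x -> R (q * x) /\ R (x * q).
Proof.
have [I [idI Iq]] := denominators [:: q].
by exists I; split=> //; apply: Iq; rewrite mem_head.
Qed.

Lemma faithful_r I q : nonzero_ideal R I -> q != 0 ->
  exists2 x, I x & q * x != 0.
Proof.
move=> /nonzero_ideal_neq[idI IN] qN.
have [qIN _] := martindale_faithful quotR idI IN qN.
have [_ I0 _ _] := idI.
have [|_ [x Ix <-]] := (nonzero_setP _).1 qIN; last by exists x.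
by exists 0 => //; rewrite mulr0.
Qed.

Lemma faithful_l I q : nonzero_ideal R I -> q != 0 ->
  exists2 x, I x & x * q != 0.
Proof.
move=> /nonzero_ideal_neq[idI IN] qN.
have [_ qIN] := martindale_faithful quotR idI IN qN.
have [_ I0 _ _] := idI.
have [|_ [x Ix <-]] := (nonzero_setP _).1 qIN; last by exists x.
by exists 0 => //; rewrite mul0r.
Qed.

Lemma nonzero_ideal_sub I x : nonzero_ideal R I -> I x -> R x.
Proof. by move=> [[IR _ _ _] _] /IR. Qed.

(** The elementwise form of primeness, extended from R to Q. If a I b = 0, the
elements of R that annihilate I b on the left form an ideal K, nonzero because
it contains suitable multiples x a, and the right annihilator W of K is an
ideal containing a nonzero x b y with x in I; but K W = 0. *)
Lemma prime_elements I a b : nonzero_ideal R I -> a != 0 -> b != 0 ->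
  exists2 x, I x & a * x * b != 0.
Proof.
move=> nI aN bN; apply: contrapT => noI.
have aIb x : I x -> a * x * b = 0.
  by move=> Ix; apply: contrapT => /eqP N; apply: noI; exists x.
have [[IR I0 IB IM] _] := nI.
pose K := [set k | R k /\ forall x, I x -> k * x * b = 0].
have nK : nonzero_ideal R K.
  split; last first.
    have [J [nJ Ja]] := denominator a; have [x Jx xaN] := faithful_l nJ aN.
    exists (x * a) => //; split; first by case: (Ja _ Jx).
    by move=> y Iy; rewrite -!mulrA [a * _]mulrA aIb // mulr0.
  split=> [k []//||k l [Rk Kk] [Rl Kl]|r k Rr [Rk Kk]].
  - by split=> [|x _]; [exact: prime_ring0 | rewrite !mul0r].
  - split=> [|x Ix]; first exact: prime_ringB.
    by rewrite !mulrBl Kk // Kl // subrr.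
  - split; split; try exact: prime_ringM.
      by move=> x Ix; rewrite -!mulrA [k * _]mulrA Kk // mulr0.
    by move=> x Ix; rewrite -[k * _ * _]mulrA Kk //; case: (IM r x).
pose W := [set w | R w /\ forall k, K k -> k * w = 0].
have nW : nonzero_ideal R W.
  split; last first.
    have [J [nJ Jb]] := denominator b; have [y Jy byN] := faithful_r nJ bN.
    have [x Ix xbyN] := faithful_l nI byN.
    exists (x * (b * y)) => //; split.
      by apply: prime_ringM; [exact: IR | case: (Jb _ Jy)].
    by move=> k [_ Kk]; rewrite !mulrA Kk // mul0r.
  split=> [k []//||k l [Rk Kk] [Rl Kl]|r k Rr [Rk Kk]].
  - by split=> [|x _]; [exact: prime_ring0 | rewrite mulr0].
  - split=> [|x Ix]; first exact: prime_ringB.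
    by rewrite mulrBr Kk // Kl // subrr.
  - split; split; try exact: prime_ringM.
      move=> x Kx; rewrite mulrA Kk //.
      by case: nK => -[_ _ _ KM] _; case: (KM r x).
    by move=> x Kx; rewrite mulrA Kk // mul0r.
have KW0 : ideal_product K W 0.
  by exists 0%N, (fun=> 0), (fun=> 0); split=> [[]|[]|] //; rewrite big_ord0.
have [|x [n [k [w [Kk Ww ->]]]]] := (nonzero_setP KW0).1 _.
  move/nonzero_ideal_neq: nK => [idK KN].
  move/nonzero_ideal_neq: nW => [idW WN].
  by case: primeR => _ _; apply.
rewrite big1 ?eqxx // => i _.
by case: (Ww i) => _; apply; apply: Kk.
Qed.

(** Any p in Q is a fraction x |-> p x on an ideal of R, so commuting with R is
enough to be central in Q. *)
Lemma commutes_with_ring q :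
  (forall r, R r -> q * r = r * q) -> exists c : C, q = c%:A.
Proof.
move=> qR; suff : center [set: Q] q by rewrite centerQ => -[c _ <-]; exists c.
split=> // p _; apply/eqP; rewrite -subr_eq0; apply: contraT => N.
have [J [nJ Jp]] := denominator p; have [x Jx] := faithful_r nJ N.
rewrite mulrBl -!mulrA (qR x) ?mulrA; last exact: nonzero_ideal_sub Jx.
by rewrite -mulrA qR ?mulrA ?subrr ?eqxx //; case: (Jp _ Jx).
Qed.

(** The heart of the matter, and the only use of the universal property of Q.
Let K hold of the multiplications killing all the vectors but b. If those that
also kill b always killed a, sending the value at b to the value at a would
define a map f which is both left and right linear. *)
Lemma two_sided_separates (bs : seq Q) a : ~ lin_span bs a ->
  exists s, [/\ coefs_in R s, forall b, b \in bs -> two_sided s b = 0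
                & two_sided s a != 0].
Proof.
elim: bs a => [|b bs IH] a.
  move=> /eqP aN; have [x Rx xaN] := faithful_l nonzero_ideal_self aN.
  have [y Ry xayN] := faithful_r nonzero_ideal_self xaN.
  exists [:: (x, y)]; split=> [p||] //; first by rewrite inE => /eqP ->.
  by rewrite two_sided_cons /two_sided big_nil addr0.
move=> nspan; apply: contrapT => nosep.
pose K s := coefs_in R s /\ forall b, b \in bs -> two_sided s b = 0.
have KR0 s : K s -> two_sided s b = 0 -> two_sided s a = 0.
  move=> [Rs Ks] sb; apply: contrapT => /eqP saN; apply: nosep; exists s.
  by split=> // d; rewrite inE => /predU1P[->|/Ks].
have Kl x s : R x -> K s -> K (lscale x s).
  move=> Rx [Rs Ks]; split=> [|d /Ks ds].
    by apply: coefs_in_lscale => // y; apply: prime_ringM.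
  by rewrite two_sided_lscale ds mulr0.
have Kr x s : R x -> K s -> K (rscale s x).
  move=> Rx [Rs Ks]; split=> [|d /Ks ds].
    by apply: coefs_in_rscale => // y Ry; apply: prime_ringM.
  by rewrite two_sided_rscale ds mul0r.
have KB s t : K s -> K t -> exists2 u, K u &
    forall x, two_sided u x = two_sided s x - two_sided t x.
  move=> [Rs Ks] [Rt Kt]; exists (s ++ lscale (-1) t) => [|x]; last first.
    by rewrite two_sided_cat two_sided_lscale mulN1r.
  split=> [|d ds].
    apply: coefs_in_cat => //; apply: coefs_in_lscale => // x Rx.
    rewrite mulN1r; exact: prime_ringN.
  by rewrite two_sided_cat two_sided_lscale Ks // Kt // mulr0 addr0.
have [spanb|nspanb] := pselect (lin_span bs b).
  have [|s [Rs Ks /eqP saN]] := IH a.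
    by apply: contra_not nspan => spana; exists 0; rewrite scale0r subr0.
  by apply: saN; apply: KR0 => //; apply: two_sided_span spanb.
(* Values need not lie in R, so only the multiplications with both values in R
   are kept; clearing denominators on the left produces enough of them. *)
pose good s := [/\ K s, R (two_sided s b) & R (two_sided s a)].
pose I := [set x | exists2 s, good s & x = two_sided s b].
have inI s : good s -> I (two_sided s b) by exists s.
have goodl x s : R x -> good s -> good (lscale x s).
  move=> Rx [Ks sb sa]; split; first exact: Kl.
    by rewrite two_sided_lscale; apply: prime_ringM.
  by rewrite two_sided_lscale; apply: prime_ringM.
have goodr x s : R x -> good s -> good (rscale s x).
  move=> Rx [Ks sb sa]; split; first exact: Kr.
    by rewrite two_sided_rscale; apply: prime_ringM.
  by rewrite two_sided_rscale; apply: prime_ringM.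
have cleared s : K s -> exists J, nonzero_ideal R J /\
    forall x, J x -> good (lscale x s).
  move=> Ks.
  have [J [nJ Js]] := denominators [:: two_sided s b; two_sided s a].
  exists J; split=> // x Jx.
  split; first by apply: Kl => //; apply: nonzero_ideal_sub Jx.
    by rewrite two_sided_lscale; case: (Js _ (mem_head _ _) _ Jx).
  rewrite two_sided_lscale.
  by case: (Js (two_sided s a) _ _ Jx); rewrite ?inE ?eqxx ?orbT.
have nI : nonzero_ideal R I.
  split; last first.
    have [s [Rs Ks sbN]] := IH _ nspanb.
    have [J [nJ Js]] := cleared s (conj Rs Ks).
    have [x Jx xN] := faithful_l nJ sbN.
    exists (x * two_sided s b) => //.
    by rewrite -two_sided_lscale; apply/inI/Js.
  split=> [_ [s [_ Rsb _] ->]||_ _ [s [Ks sb sa] ->] [t [Kt tb ta] ->]|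
           r _ Rr [s gs ->]] //.
  - exists [::]; last by rewrite /two_sided big_nil.
    split; [|by rewrite /two_sided big_nil; apply: prime_ring0..].
    by split=> // d _; rewrite /two_sided big_nil.
  - have [u Ku uE] := KB _ _ Ks Kt; rewrite -uE; apply: inI.
    by split=> //; rewrite uE; apply: prime_ringB.
  - rewrite -two_sided_lscale -two_sided_rscale.
    by split; apply: inI; [exact: goodl | exact: goodr].
have [f fI] : exists f : Q -> Q, forall x, I x ->
    exists2 s, good s & x = two_sided s b /\ f x = two_sided s a.
  have /choice[f fP] : forall x, exists y, I x -> exists2 s, good s &
    x = two_sided s b /\ y = two_sided s a; last by exists f.
  move=> x.
  have [[s gs xE]|nIx] := pselect (I x); last by exists 0.
  by exists (two_sided s a) => _; exists s.
have fE s : good s -> f (two_sided s b) = two_sided s a.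
  move=> gs; have [t [Kt _ _] [tb ->]] := fI _ (inI _ gs).
  have [Ks _ _] := gs; have [u Ku uE] := KB _ _ Kt Ks.
  by apply/subr0_eq; rewrite -uE; apply: KR0 => //; rewrite uE tb subrr.
have fR x : I x -> R (f x) by move=> /fI[s [_ _ Ra] [_ ->]].
have fD x y : I x -> I y -> f (x + y) = f x + f y.
  move=> [s gs ->] [t gt ->].
  have gt' : good (lscale (-1) t).
    case: gt => -[Rt Kt] tb ta; split; last 2 first.
    - by rewrite two_sided_lscale mulN1r; apply: prime_ringN.
    - by rewrite two_sided_lscale mulN1r; apply: prime_ringN.
    split.
      apply: coefs_in_lscale => // z Rz.
      by rewrite mulN1r; apply: prime_ringN.
    by move=> d ds; rewrite two_sided_lscale Kt // mulr0.
  have [[Ks sb sa] [Kt tb ta]] := (gs, gt'); have [u Ku uE] := KB _ _ Ks Kt.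
  have -> : two_sided s b + two_sided t b = two_sided u b.
    by rewrite uE two_sided_lscale mulN1r opprK.
  rewrite fE ?fE //; first by rewrite uE two_sided_lscale mulN1r opprK.
  by split=> //; rewrite uE; apply: prime_ringB.
have fr x r : I x -> R r -> f (x * r) = f x * r.
  move=> [s gs ->] Rr; rewrite -two_sided_rscale !fE //; last exact: goodr.
  by rewrite two_sided_rscale.
have fl r x : R r -> I x -> f (r * x) = r * f x.
  move=> Rr [s gs ->]; rewrite -two_sided_lscale !fE //; last exact: goodl.
  by rewrite two_sided_lscale.
have [q qE] : exists q, forall x y, I x -> I y -> f y = q * y /\ f x = x * q.
  move/nonzero_ideal_neq: (nI) => [idI IN].
  apply: (martindale_balanced quotR idI IN) => // x y Ix Iy.
  by rewrite -fr -?fl //; apply: nonzero_ideal_sub; eassumption.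
(* Both f (r x) = r f x and f x = q x hold, so q r - r q kills I. *)
have [c qc] : exists c : C, q = c%:A.
  apply: commutes_with_ring => r Rr.
  apply/eqP; rewrite -subr_eq0; apply: contraT => N.
  have [x Ix] := faithful_r nI N.
  have Irx : I (r * x) by case: nI => -[_ _ _ IM] _; case: (IM r x).
  rewrite mulrBl -mulrA -(qE _ _ Irx Irx).1 fl // (qE _ _ Ix Ix).1.
  by rewrite mulrA subrr eqxx.
have [|s [Rs Ks]] := IH (a - c *: b).
  by apply: contra_not nspan => ?; exists c.
have [J [nJ Js]] := cleared s (conj Rs Ks).
rewrite -scaleNr addrC two_sided_linear => N.
have [x Jx] := faithful_l nJ N; case/eqP.
have gx := Js _ Jx.
rewrite mulrDr -scalerAr -!two_sided_lscale -(fE _ gx).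
by rewrite (qE _ _ (inI _ gx) (inI _ gx)).1 qc mulr_algl scaleNr addNr.
Qed.

(** Separating one right coefficient from all the others isolates a single
term: a two-sided multiplication is zero, or composing and multiplying it with
elements of R gives x |-> a x w with a and w nonzero. Finite rank and
vanishing on an ideal are inherited by the latter, where they are easy to
exploit. *)
Lemma two_sided_reduce s :
  (forall x, two_sided s x = 0) \/
  exists a w t, [/\ a != 0, w != 0, coefs_in R t &
    forall x, \sum_(p <- t) two_sided s (x * p.1) * p.2 = a * x * w].
Proof.
have [n] := ubnP (size s); elim: n s => // n IH [_|[a b] s /=].
  by left=> x; rewrite /two_sided big_nil.
rewrite ltnS => szs.
have [/(two_sided_absorb a)[t [szt tE]]|nspan] :=
    pselect (lin_span [seq p.2 | p <- s] b).
  have [|t0|[a' [w [u [aN wN Ru uE]]]]] := IH t; first by rewrite szt.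
    by left=> x; rewrite tE.
  by right; exists a', w, u; split=> // x; under eq_bigr do rewrite tE.
have [a0|aN] := eqVneq a 0.
  have as0 x : two_sided ((a, b) :: s) x = two_sided s x.
    by rewrite two_sided_cons /= a0 !mul0r add0r.
  have [//|s0|[a' [w [u [aN wN Ru uE]]]]] := IH s.
    by left=> x; rewrite as0.
  by right; exists a', w, u; split=> // x; under eq_bigr do rewrite as0.
have [t [Rt tbs tb]] := two_sided_separates nspan.
right; exists a, (two_sided t b), t; split=> // x.
under eq_bigr do rewrite two_sided_cons mulrDl /=.
rewrite big_split /= [X in _ + X](_ : _ = 0) ?addr0; last first.
  rewrite /two_sided; under eq_bigr do rewrite mulr_suml.
  rewrite exchange_big big_seq big1 //= => p sp.
  transitivity (p.1 * x * two_sided t p.2); last by rewrite tbs ?mulr0 ?map_f.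
  by rewrite mulr_sumr; apply: eq_bigr => u _; rewrite !mulrA.
by rewrite mulr_sumr; apply: eq_bigr => u _; rewrite !mulrA.
Qed.

Lemma two_sided_eq0 I s : nonzero_ideal R I ->
  (forall x, I x -> two_sided s x = 0) -> forall q, two_sided s q = 0.
Proof.
move=> nI sI; have [//|[a [w [t [aN wN Rt tE]]]]] := two_sided_reduce s.
have [x Ix] := prime_elements nI aN wN; rewrite -tE big_seq big1 ?eqxx //.
move=> p /Rt[R1 R2]; rewrite sI ?mul0r //.
by case: nI => -[_ _ _ IM] _; case: (IM p.1 x).
Qed.

End Martindale.

(** * Independent words and finite rank *)

Section Words.

(** Words over the letters below k in which the largest letter occurs at most
once, the two pieces around it being words of the same kind. They include all
words without repeated letters, and unlike those they form a full product
set, in which left and right factors vary independently. *)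
Fixpoint words (k : nat) : seq (seq nat) :=
  if k is k'.+1 then
    words k' ++ [seq u ++ k' :: v | u <- words k', v <- words k']
  else [:: [::]].

Lemma words_lt k w : w \in words k -> all (ltn^~ k) w.
Proof.
elim: k w => [|k IH] w /=; first by rewrite inE => /eqP ->.
have lt u : u \in words k -> all (ltn^~ k.+1) u.
  by move=> /IH; apply: sub_all => i /= /ltnW.
rewrite mem_cat => /orP[/lt//|/allpairsP[[u v] /= [/lt Wu /lt Wv ->]]].
by rewrite all_cat Wu /= ltnSn.
Qed.

Lemma words_notin k w : w \in words k -> k \notin w.
Proof.
by move=> /words_lt/allP wk; apply/negP => /wk /=; rewrite ltnn.
Qed.

Lemma cat_cons_inj (T : eqType) (a : T) u v u' v' :
  a \notin u -> a \notin u' -> u ++ a :: v = u' ++ a :: v' -> u = u' /\ v = v'.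
Proof.
elim: u u' => [|x u IH] [|x' u'] //=.
- by move=> _ _ [->].
- by move=> _; rewrite inE => /norP[/eqP ax _] [ax']; case: ax.
- by rewrite inE => /norP[/eqP ax _] _ [ax']; case: ax.
- rewrite !inE => /norP[_ nu] /norP[_ nu'] [-> /(IH _ nu nu')[-> ->]].
  by [].
Qed.

Lemma words_uniq k : uniq (words k).
Proof.
elim: k => //= k IH; rewrite cat_uniq IH /=; apply/andP; split.
  apply/hasPn => _ /allpairsP[[u v] /= [_ _ ->]].
  apply: contraL (_ : k \in u ++ k :: v); first exact: words_notin.
  by rewrite mem_cat mem_head orbT.
apply: allpairs_uniq => // -[u v] [u' v'] /allpairsP[[x y] /= [Wx _ [-> ->]]].
move=> /allpairsP[[x' y'] /= [Wx' _ [-> ->]]] /=.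
by move=> /(cat_cons_inj (words_notin Wx) (words_notin Wx'))[-> ->].
Qed.

Lemma uniq_in_words k w : uniq w -> all (ltn^~ k) w -> w \in words k.
Proof.
elim: k w => [|k IH] w /=; first by case: w.
move=> uw wk; rewrite mem_cat; have [kw|nkw] := boolP (k \in w); last first.
  rewrite IH //; apply/allP => i wi /=.
  have := allP wk i wi; rewrite /= ltnS leq_eqVlt => /predU1P[ik|//].
  by rewrite -ik wi in nkw.
case/splitPr: kw uw wk => u v.
rewrite cat_uniq /= => /and3P[uu /norP[nuk nuv] /andP[nvk uv]].
rewrite all_cat /= => /and3P[uk _ vk].
have lt t : k \notin t -> all (ltn^~ k.+1) t -> all (ltn^~ k) t.
  move=> nt /allP tk; apply/allP => i ti /=.
  have := tk i ti; rewrite /= ltnS leq_eqVlt => /predU1P[ik|//].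
  by rewrite -ik ti in nt.
by apply/orP; right; apply: allpairs_f; apply: IH => //; apply: lt.
Qed.

End Words.

Definition monomial (Q : nzRingType) (y : nat -> Q) (w : seq nat) : Q :=
  \prod_(i <- w) y i.

Definition multilinear_identity (C : fieldType) (Q : algType C) (R : set Q)
    (n : nat) (c : seq nat -> C) : Prop :=
  forall y : nat -> Q, (forall i, R (y i)) ->
    \sum_(w <- permutations (iota 0 n)) c w *: monomial y w = 0.

Section FiniteDimension.

Context (C : fieldType) (Q : algType C) (R : set Q).
Hypothesis primeR : prime_ring R.
Hypothesis quotR : symmetric_martindale R.
Hypothesis centerQ : center [set: Q] = scalars Q.

(** Multiplications by a_i on the left and by independent b_i on the right are
independent: separate b_i from the other b_j. *)
Lemma two_sided_independent (I : eqType) (r : seq I) (a b : I -> Q) :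
    uniq r -> independent [set 0] r b ->
    (forall x, R x -> \sum_(i <- r) a i * x * b i = 0) ->
  forall i, i \in r -> a i = 0.
Proof.
move=> ur indb sum0 i ri.
have ur' : uniq (rem i r) by rewrite rem_uniq.
have nri : i \notin rem i r by rewrite mem_rem_uniqF.
have [|s [Rs sb siN]] :=
    two_sided_separates primeR quotR centerQ (bs := map b (rem i r)) (a := b i).
  move=> /(lin_span_family ur')[e bE].
  have := indb (extend_coef i 1 (fun j => - e j)) _ i ri.
  rewrite /extend_coef eqxx -/(extend_coef _ _ _) => b0.
  suff /b0/eqP : \sum_(j <- r) extend_coef i 1 (fun j => - e j) j *: b j = 0.
    by rewrite oner_eq0.
  rewrite (perm_big _ (perm_to_rem ri)) sum_extend_coef // scale1r bE.
  by under [X in _ + X]eq_bigr do rewrite scaleNr; rewrite sumrN subrr.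
apply: contrapT => /eqP aiN; have nR := nonzero_ideal_self primeR.
have [x Rx] := prime_elements primeR quotR nR aiN siN; case/eqP.
transitivity (\sum_(j <- r) a j * x * two_sided s (b j)).
  rewrite (perm_big _ (perm_to_rem ri)) big_cons /= [X in _ + X]big1_seq.
    by rewrite addr0.
  by move=> j /andP[_ rj]; rewrite sb ?mulr0 ?map_f.
rewrite /two_sided; under eq_bigr do rewrite mulr_sumr.
rewrite exchange_big big1_seq //= => p /Rs[Rp _].
transitivity ((\sum_(j <- r) a j * (x * p.1) * b j) * p.2).
  by rewrite mulr_suml; apply: eq_bigr => j _; rewrite !mulrA.
by rewrite sum0 ?mul0r //; apply: (prime_ringM primeR).
Qed.

(** If only zero has finite rank, values can be chosen so that all the words
above are independent. The new words u k v are values at the new letter of the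
multiplications x |-> u x v, which are independent because the old words are;
Amitsur's lemma makes them independent modulo the span of the old words. *)
Lemma independent_words :
    (forall s, fin_dim [set two_sided s x | x in R] ->
       forall x, R x -> two_sided s x = 0) ->
  forall k, exists2 y : nat -> Q, forall i, R (y i) &
    independent [set 0] (words k) (monomial y).
Proof.
move=> norank; elim=> [|k [y Ry indy]].
  exists (fun=> 0) => [_|c]; first exact: (prime_ring0 primeR).
  rewrite /= big_cons /monomial !big_nil addr0 => c0 w.
  rewrite inE => /eqP ->; apply/eqP; move/eqP: c0.
  by rewrite scaler_eq0 oner_eq0 orbF.
pose W := words k; pose P := [seq (u, v) | u <- W, v <- W].
pose T (p : seq nat * seq nat) x := monomial y p.1 * x * monomial y p.2.
have subW : subspace (thicken [set 0] W (monomial y)).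
  by apply: thicken_subspace; split=> //= c x z -> ->; rewrite scaler0 addr0.
have finW : fin_dim (thicken [set 0] W (monomial y)).
  by apply: thicken_fin_dim; exists [::].
have uW : uniq W := words_uniq k.
have uP : uniq P by apply: allpairs_uniq => // -[? ?] [? ?].
have TD p x z : T p (x + z) = T p x + T p z by rewrite /T mulrDr mulrDl.
have [|x Rx indx] := simultaneously_independent (prime_ring0 primeR)
    (prime_ringD primeR) TD uP _ subW finW.
  move=> c finc.
  pose s := [seq (c p *: monomial y p.1, monomial y p.2) | p <- P].
  have sE x : two_sided s x = \sum_(p <- P) c p *: T p x.
    by rewrite /two_sided big_map; apply: eq_bigr => p _; rewrite /T -!scalerAl.
  have s0 x : R x -> two_sided s x = 0.
    apply: norank; apply: fin_dim_sub finc => _ [z Rz <-].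
    by exists z => //; rewrite sE.
  move=> _ /allpairsP[[u0 v0] /= [Wu0 Wv0 ->]].
  apply: (indy (fun u => c (u, v0))) Wu0 => /=; move: v0 Wv0.
  apply: (two_sided_independent uW indy) => z Rz.
  rewrite -[RHS](s0 _ Rz) sE big_allpairs exchange_big /=.
  apply: eq_bigr => v _; rewrite !mulr_suml.
  by apply: eq_bigr => u _; rewrite /T -!scalerAl.
pose y' i := if i == k then x else y i.
have y'E w : w \in W -> monomial y' w = monomial y w.
  move=> /words_lt/allP wk; apply: eq_big_seq => i /wk.
  by rewrite /y' /= ltn_neqAle => /andP[/negPf ->].
have y'P u v : u \in W -> v \in W -> monomial y' (u ++ k :: v) = T (u, v) x.
  move=> Wu Wv; rewrite /monomial big_cat big_cons /= -/(monomial _ _).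
  by rewrite -/(monomial y' v) !y'E // /y' eqxx mulrA.
exists y' => [i|c]; first by rewrite /y'; case: ifP.
rewrite /= big_cat /= [X in _ + X](_ : _ =
    \sum_(p <- P) c (p.1 ++ k :: p.2) *: T p x); last first.
  rewrite [LHS]big_allpairs_dep big_allpairs; apply: eq_big_seq => u Wu.
  by apply: eq_big_seq => v Wv; rewrite y'P.
rewrite (eq_big_seq (fun w => c w *: monomial y w)); last by move=> w /y'E ->.
move=> sum0.
have cP p : p \in P -> c (p.1 ++ k :: p.2) = 0.
  apply: indx (fun p => c (p.1 ++ k :: p.2)) _ _; exists (fun w => - c w) => /=.
  by under [X in _ - X]eq_bigr do rewrite scaleNr; rewrite sumrN opprK addrC.
have cW w : w \in W -> c w = 0.
  apply: (indy c _ w); rewrite /= -[RHS]sum0 [X in _ = _ + X]big1_seq ?addr0 //.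
  by move=> p /andP[_ /cP ->]; rewrite scale0r.
move=> w; rewrite mem_cat => /orP[/cW//|/allpairsP[[u v] /= [Wu Wv ->]]].
by apply: (cP (u, v)); apply: allpairs_f.
Qed.

(** A multilinear identity is a linear relation between words without repeated
letters. *)
Lemma identity_finite_rank n c :
    multilinear_identity R n c -> c (iota 0 n) != 0 ->
  exists s, fin_dim [set two_sided s x | x in R] /\
    exists2 x, R x & two_sided s x != 0.
Proof.
move=> idc cN; apply: contrapT => noS.
have [|y Ry indy] := independent_words _ n.
  move=> s fins x Rx; apply: contrapT => /eqP sN; apply: noS; exists s.
  by split=> //; exists x.
pose P := permutations (iota 0 n).
have PW w : w \in P -> w \in words n.
  rewrite mem_permutations => Pw; apply: uniq_in_words.
    by rewrite (perm_uniq Pw) iota_uniq.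
  by apply/allP => i; rewrite (perm_mem Pw) mem_iota.
case/eqP: cN; have Pn : iota 0 n \in P by rewrite mem_permutations.
have := indy (fun w => if w \in P then c w else 0) _ _ (PW _ Pn).
rewrite Pn; apply=> /=; rewrite -[RHS](idc y Ry) -/P.
transitivity (\sum_(w <- words n | w \in P) c w *: monomial y w).
  rewrite [RHS]big_mkcond; apply: eq_bigr => w _.
  by case: ifP; rewrite ?scale0r.
rewrite -big_filter; apply: perm_big; apply: uniq_perm.
- by rewrite filter_uniq ?words_uniq.
- exact: permutations_uniq.
by move=> w; rewrite mem_filter andb_idr //; apply: PW.
Qed.

(** * From finite rank to finite dimension *)

(** Once a R w is finite-dimensional, so is c' R c' for c' = w y a, where y in R
keeps c' nonzero; a left denominator then moves c' into R. *)
Lemma corner_fin_dim s : fin_dim [set two_sided s x | x in R] ->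
    (exists2 x, R x & two_sided s x != 0) ->
  exists c, [/\ R c, c != 0 & fin_dim [set c * x * c | x in R]].
Proof.
move=> [bs sbs] [x0 _ sx0].
have [s0|[a [w [t [aN wN Rt tE]]]]] := two_sided_reduce primeR quotR centerQ s.
  by rewrite s0 eqxx in sx0.
pose ds := [seq b * p.2 | p <- t, b <- bs].
have ads x : R x -> lin_span ds (a * x * w).
  move=> Rx; rewrite -tE; apply: subspace_sum => [|p tp].
    exact: lin_span_subspace.
  have [Rp _] := Rt _ tp.
  apply: (@lin_span_sub _ _ (map ( *%R^~ p.2) bs)).
    by move=> _ /mapP[b bsb ->]; apply: allpairs_f.
  apply: lin_span_map => [k u v|]; first by rewrite mulrDl -scalerAl.
  by apply: sbs; exists (x * p.1) => //; apply: (prime_ringM primeR).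
have nR := nonzero_ideal_self primeR.
have [y Ry wyaN] := prime_elements primeR quotR nR wN aN.
have [J [nJ Jc]] := denominator primeR quotR (w * y * a).
have [z Jz cN] := faithful_l quotR nJ wyaN.
exists (z * (w * y * a)); split=> //; first by case: (Jc _ Jz).
have Rz := nonzero_ideal_sub nJ Jz.
pose h u := z * w * y * u * (y * a).
have hlin : linear h.
  by move=> k u v; rewrite /h mulrDr mulrDl -scalerAr -scalerAl.
exists (map h ds) => _ [x Rx <-].
have -> : z * (w * y * a) * x * (z * (w * y * a)) = h (a * (x * z) * w).
  by rewrite /h !mulrA.
by apply: lin_span_map => //; apply: ads; apply: (prime_ringM primeR).
Qed.

Lemma descending_product (y : nat -> Q) w :
  (forall i j, (i <= j)%N -> y j * y i = 0) -> monomial y w != 0 ->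
  sorted ltn w.
Proof.
move=> desc; elim: w => // i [//|j w] IH N.
have yN : monomial y (j :: w) != 0.
  apply: contraNneq N => m0.
  by rewrite /monomial big_cons -/(monomial _ _) m0 mulr0.
have /= pw := IH yN; rewrite /= pw andbT ltnNge; apply: contra N => ji.
by rewrite /monomial !big_cons mulrA desc // mul0r.
Qed.

(** Take u in R c not annihilated by the product p obtained so far. Right
multiplication by u maps c R into the span of c R c, and right multiplication
by each earlier y_i has finite rank on c R as well, so some nonzero v in the
span of c R kills u and all the y_i. The next element is u z v, where z in R
clears the denominators of v and keeps p u z v nonzero. *)
Lemma staircase c : R c -> c != 0 -> fin_dim [set c * x * c | x in R] ->
    ~ fin_dim (span_of [set c * x | x in R]) ->
  forall n, exists y : nat -> Q,
    [/\ forall i, R (y i), forall i j, (i <= j)%N -> y j * y i = 0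
      & monomial y (iota 0 n) != 0].
Proof.
move=> Rc cN finc infU n; set U := span_of _ in infU.
have subU : subspace U by exact: span_of_subspace.
have mulrlin (e : Q) : linear ( *%R^~ e).
  by move=> k u v /=; rewrite mulrDl -scalerAl.
suff [y [? ? ? ?]] : exists y : nat -> Q,
    [/\ forall i, R (y i), forall i j, (i <= j)%N -> y j * y i = 0,
        monomial y (iota 0 n) != 0,
        forall i, fin_dim [set v * y i | v in U]
      & forall i, (n <= i)%N -> y i = 0] by exists y.
elim: n => [|n [y [Ry desc pN finy y0]]].
  exists (fun=> 0); split=> [_|i j _||i|] //.
  - exact: (prime_ring0 primeR).
  - by rewrite mulr0.
  - by rewrite /monomial big_nil oner_neq0.
  - by exists [::] => _ [v _ <-]; rewrite mulr0.
have nR := nonzero_ideal_self primeR.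
have [r Rr purN] := prime_elements primeR quotR nR pN cN.
set p := monomial y (iota 0 n) in pN purN; pose u := r * c.
have Ru : R u by apply: (prime_ringM primeR).
have finu : fin_dim [set v * u | v in U].
  have [s sc] := finc; exists s => _ [v Uv <-].
  suff US : U `<=` [set v | lin_span s (v * u)] by apply: US.
  apply: span_of_min.
    have [s0 sD] := lin_span_subspace s.
    split=> [|k a b /= sa sb]; first by rewrite /= mul0r.
    by rewrite mulrDl -scalerAl; apply: sD.
  move=> _ [x Rx <-]; apply: sc; exists (x * r).
    exact: (prime_ringM primeR).
  by rewrite /u !mulrA.
pose es := u :: [seq y i | i <- iota 0 n].
have [|v [Uv ev] vN] := nonzero_of_infinite
    (infinite_common_kernel (r := es) (h := fun e v => v * e)
       mulrlin subU infU _).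
  by move=> e; rewrite inE => /predU1P[->//|/mapP[i _ ->]].
have vu : v * u = 0 by apply: ev; rewrite mem_head.
have vy i : v * y i = 0.
  have [/y0 ->|lt_i] := leqP n i; first by rewrite mulr0.
  by apply: ev; rewrite inE map_f ?orbT // mem_iota.
have [J [nJ Jv]] := denominator primeR quotR v.
have puN : p * u != 0 by rewrite /u mulrA.
(* The factorization of u is hidden from rewriting modulo associativity. *)
clearbody u.
have [z Jz xN] := prime_elements primeR quotR nJ puN vN.
pose x := u * z * v.
have Rx : R x.
  by rewrite /x -mulrA; apply: (prime_ringM primeR) => //; case: (Jv _ Jz).
exists (fun i => if i == n then x else y i); split.
- by move=> i; case: ifP.
- move=> i j le_ij; case: (eqVneq j n); case: (eqVneq i n) => i_n jn.
  + by rewrite /= /x -!mulrA [v * _]mulrA vu mul0r !mulr0.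
  + by rewrite /= /x -!mulrA vy !mulr0.
  + by rewrite [y j]y0 ?mul0r // -i_n.
  + exact: desc.
- rewrite -addn1 iotaD /monomial big_cat big_seq1 /= eqxx.
  rewrite (_ : \prod_(i <- _) _ = p) 1?/x ?mulrA //.
  apply: eq_big_seq => i.
  by rewrite mem_iota add0n /= ltn_neqAle => /andP[/negPf ->].
- move=> i; case: ifP => // _.
  apply: fin_dim_sub (fin_dim_image (mulrlin (z * v)) finu) => _ [e Ue <-].
  by exists (e * u); [exists e | rewrite /x !mulrA].
- by move=> i lt_ni; rewrite gtn_eqF // y0 // ltnW.
Qed.

(** On a staircase only the increasing monomial survives, which contradicts the
identity; so d R is finite-dimensional. If R were not, a nonzero combination v
of elements of R would be killed by all of d R, against primeness. *)
Lemma identity_fin_dim n c :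
  multilinear_identity R n c -> c (iota 0 n) != 0 -> fin_dim R.
Proof.
move=> idc cN; have [s [fins sN]] := identity_finite_rank idc cN.
have [d [Rd dN find]] := corner_fin_dim fins sN.
pose U := span_of [set d * x | x in R].
have subU : subspace U by exact: span_of_subspace.
have finU : fin_dim U.
  apply: contrapT => infU; have [y [Ry desc pN]] := staircase Rd dN find infU n.
  have := idc y Ry.
  rewrite (bigD1_seq (iota 0 n)) ?mem_permutations ?permutations_uniq //=.
  rewrite big1_seq ?addr0 => [/eqP|w /andP[wN]].
    by rewrite scaler_eq0 (negPf cN) (negPf pN).
  rewrite mem_permutations => Pw.
  have [->|/(descending_product desc) wsort] := eqVneq (monomial y w) 0.
    by rewrite scaler0.
  case/eqP: wN; apply: (irr_sorted_eq ltn_trans ltnn) => //.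
    exact: iota_ltn_sorted.
  exact: perm_mem.
have [t [tU Ut]] := basis_in_subspace subU finU.
have mullin (e : Q) : linear ( *%R e).
  by move=> k u v /=; rewrite mulrDr -scalerAr.
apply: contrapT => infR; pose V := span_of R.
have subV : subspace V by exact: span_of_subspace.
have infV : ~ fin_dim V.
  by apply: contra_not infR; apply: fin_dim_sub; apply: sub_span_of.
have [|v [Vv tv] vN] := nonzero_of_infinite
    (infinite_common_kernel (r := t) (h := fun e v => e * v)
       mullin subV infV _).
  move=> e /tU Ue; apply: fin_dim_sub finU => _ [v Vv <-].
  suff VS : V `<=` [set v | U (e * v)] by apply: VS.
  apply: span_of_min.
    case: subU => U0 UD; split=> [|k a b /= Ua Ub]; first by rewrite /= mulr0.
    by rewrite mulrDr -scalerAr; apply: UD.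
  move=> x Rx; suff US : U `<=` [set e | U (e * x)] by apply: US.
  apply: span_of_min.
    case: subU => U0 UD; split=> [|k a b /= Ua Ub]; first by rewrite /= mul0r.
    by rewrite mulrDl -scalerAl; apply: UD.
  move=> _ [y Ry <-]; apply: sub_span_of; exists (y * x).
    exact: (prime_ringM primeR).
  by rewrite mulrA.
have nR := nonzero_ideal_self primeR.
have [x Rx] := prime_elements primeR quotR nR dN vN; case/eqP.
have Udx : U (d * x) by apply: sub_span_of; exists x.
have sub0 : subspace [set e | e * v = 0].
  split=> [|k a b /= av bv]; rewrite /= ?mul0r //.
  by rewrite mulrDl -scalerAl av bv scaler0 addr0.
by apply: (lin_span_min sub0 tv); apply: Ut.
Qed.

End FiniteDimension.

(** * Multilinear identities *)

Section Colorings.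

Context (n : nat) (color : nat -> nat).

(** The words over the letters below n that become w when every letter is
replaced by its color: the terms of the expansion of w after substituting for
each indeterminate the sum of the letters of that color. *)
Fixpoint colored_words (w : seq nat) : seq (seq nat) :=
  if w is i :: w' then
    [seq j :: v | j <- [seq j <- iota 0 n | color j == i],
                  v <- colored_words w']
  else [:: [::]].

Lemma mem_colored_words w v :
  (v \in colored_words w) = (map color v == w) && all (ltn^~ n) v.
Proof.
elim: w v => [|i w IH] v /=; first by rewrite inE; case: v.
apply/allpairsP/andP => [[[j u]] /= [] | []].
  rewrite mem_filter mem_iota IH => /andP[/eqP ci jn] /andP[/eqP uw un] -> /=.
  by rewrite ci uw eqxx un andbT; split.
case: v => //= j v /eqP[ci vw] /andP[jn vn]; exists (j, v) => /=.
by rewrite mem_filter mem_iota IH ci vw !eqxx jn vn.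
Qed.

Lemma colored_words_uniq w : uniq (colored_words w).
Proof.
elim: w => //= i w IH; apply: allpairs_uniq => //.
  by rewrite filter_uniq ?iota_uniq.
by move=> [j u] [j' u'] _ _ /= [-> ->].
Qed.

Lemma monomial_colored_sum (Q : nzRingType) (z : nat -> Q) w :
  monomial (fun i => \sum_(j <- iota 0 n | color j == i) z j) w =
  \sum_(v <- colored_words w) monomial z v.
Proof.
elim: w => [|i w IH]; first by rewrite big_seq1 /monomial !big_nil.
rewrite /monomial big_cons -/(monomial _ _) IH /= big_allpairs_dep big_filter.
rewrite mulr_suml; apply: eq_bigr => j _; rewrite mulr_sumr.
by apply: eq_bigr => v _; rewrite /monomial big_cons.
Qed.

(** A word of length at most n that uses all n letters uses each exactly
once. *)
Lemma colored_permutations w : (size w <= n)%N ->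
  perm_eq [seq v <- colored_words w | all (mem v) (iota 0 n)]
          [seq v <- permutations (iota 0 n) | map color v == w].
Proof.
move=> szw; apply: uniq_perm => [||v].
- by rewrite filter_uniq ?colored_words_uniq.
- by rewrite filter_uniq ?permutations_uniq.
rewrite !mem_filter mem_permutations mem_colored_words andbCA.
have [vw|//] := eqVneq (map color v) w; rewrite /=.
have szv : (size v <= size (iota 0 n))%N.
  by rewrite size_iota -(size_map color) vw.
apply/andP/idP => [[/allP sub _]|Pv]; last first.
  split; apply/allP => i; rewrite /= -?(perm_mem Pv) ?mem_iota //.
  by rewrite (perm_mem Pv) mem_iota.
have [_ E] := uniq_min_size (iota_uniq 0 n) sub szv.
rewrite perm_sym; apply: uniq_perm (iota_uniq 0 n) _ E.
exact: leq_size_uniq (iota_uniq 0 n) sub szv.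
Qed.

End Colorings.

Section Polarization.

Context (C : fieldType) (Q : algType C).
Implicit Types (y : nat -> Q) (F : (nat -> Q) -> Q).

Definition vanish (m : nat) y : nat -> Q := fun i => if i == m then 0 else y i.

(** The iterated difference F(y) - F(y with y_m = 0), for all m < n. It keeps
exactly the monomials in which every letter below n occurs. *)
Fixpoint polarize (n : nat) F y : Q :=
  if n is m.+1 then polarize m F y - polarize m F (vanish m y) else F y.

Lemma polarize_eq0 (R : set Q) n F : R 0 ->
    (forall y, (forall i, R (y i)) -> F y = 0) ->
  forall y, (forall i, R (y i)) -> polarize n F y = 0.
Proof.
move=> R0 F0; elim: n => [|n IH] y Ry /=; first exact: F0.
by rewrite !IH ?subrr // => i; rewrite /vanish; case: ifP.
Qed.

Lemma polarize_sum n (I : Type) (r : seq I) (c : I -> C)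
    (F : I -> (nat -> Q) -> Q) y :
  polarize n (fun z => \sum_(i <- r) c i *: F i z) y =
  \sum_(i <- r) c i *: polarize n (F i) y.
Proof.
elim: n y => //= n IH y; rewrite !IH -sumrB.
by apply: eq_bigr => i _; rewrite scalerBr.
Qed.

Lemma monomial_vanish m y w :
  monomial (vanish m y) w = if m \in w then 0 else monomial y w.
Proof.
elim: w => [|i w IH]; first by rewrite /monomial !big_nil.
rewrite /monomial !big_cons -!/(monomial _ _) IH inE /vanish eq_sym.
by case: eqP => _; rewrite ?mul0r //=; case: ifP; rewrite ?mulr0.
Qed.

Lemma polarize_monomial n w y :
  polarize n (fun z => monomial z w) y =
  if all (mem w) (iota 0 n) then monomial y w else 0.
Proof.
elim: n y => // n IH y; rewrite [polarize _ _ _]/= !IH -addn1 iotaD all_cat /=.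
rewrite andbT monomial_vanish.
by case: (all _ _); case: (n \in w); rewrite ?subr0 ?subrr.
Qed.

End Polarization.

Section Multilinearization.

Context (C : fieldType) (Q : algType C) (R : set Q).

Lemma free_evalE (r : nat -> Q) (f : free_algebra C) :
  free_eval r f = \sum_(w <- msupp f) f@_w *: monomial r w.
Proof.
by rewrite /free_eval mmapE; apply: eq_bigr => w _; rewrite /= mulr_algl.
Qed.

Lemma seq_arg_max (T : eqType) (m : T -> nat) (x : T) (s : seq T) :
  x \in s -> exists2 a, a \in s & forall b, b \in s -> (m b <= m a)%N.
Proof.
elim: s x => // x [|y s] IH _ _.
  by exists x; rewrite ?mem_head // => b; rewrite inE => /eqP ->.
have [a sa amax] := IH y (mem_head _ _).
have [le_xa|/ltnW le_ax] := leqP (m x) (m a).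
  exists a => [|b]; first by rewrite inE sa orbT.
  by rewrite inE => /predU1P[->//|/amax].
exists x => [|b]; first exact: mem_head.
by rewrite inE => /predU1P[->//|/amax le_ba]; apply: leq_trans le_ax.
Qed.

(** Let w0 be a longest word of f, of length n. Color the letters 0, ..., n-1 by
the letters of w0, substitute sums of letters of equal color and polarize.
Since no word of f is longer than n, the surviving terms are permutations of
0, ..., n-1, and the identity permutation has the coefficient of w0. *)
Lemma multilinearize : subring R -> PI_ring R ->
  exists n c, multilinear_identity R n c /\ c (iota 0 n) != 0.
Proof.
move=> [R0 RB _] [f [fN idf]].
have RD := add_closed R0 RB.
have [w0 fw0 maxw0] : exists2 w0, w0 \in msupp f &
    forall w, w \in msupp f -> (size w <= size w0)%N.
  have [w fw] : exists w, w \in msupp f.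
    apply: contrapT => no; case/eqP: fN; apply/malgP => w.
    by rewrite mcoeff0 mcoeff_outdom //; apply/negP => fw; apply: no; exists w.
  exact: (seq_arg_max (fun w : {fmonom nat} => size w) fw).
pose n := size w0; pose color := nth 0%N w0.
have color0 : map color (iota 0 n) = w0 by exact: mkseq_nth.
exists n, (fun v => f@_(FMonom (map color v))).
split; last by rewrite color0 fmK mcoeff_neq0.
move=> y Ry.
pose subst (z : nat -> Q) i := \sum_(j <- iota 0 n | color j == i) z j.
have Rsubst z : (forall i, R (z i)) -> forall i, R (subst z i).
  by move=> Rz i; rewrite /subst; elim/big_rec: _ => // j x _ Rx; apply: RD.
have := polarize_eq0 n R0 (F := fun z => free_eval (subst z) f)
          (fun z Rz => idf _ (Rsubst z Rz)) Ry.
have -> : (fun z => free_eval (subst z) f) = (fun z =>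
    \sum_(w <- msupp f) f@_w *: \sum_(v <- colored_words n color w)
      (1 : C) *: monomial z v).
  apply/funext => z; rewrite free_evalE; apply: eq_bigr => w _; congr (_ *: _).
  rewrite monomial_colored_sum; apply: eq_bigr => v _.
  by rewrite scale1r.
rewrite polarize_sum => sum0; rewrite -[RHS]sum0.
transitivity (\sum_(w <- msupp f) \sum_(v <- permutations (iota 0 n) |
    map color v == w) f@_w *: monomial y v); last first.
  apply: eq_big_seq => w fw; rewrite polarize_sum scaler_sumr.
  rewrite -big_filter -(perm_big _ (colored_permutations color (maxw0 w fw))).
  rewrite big_filter big_mkcond; apply: eq_bigr => v _.
  by rewrite scale1r polarize_monomial; case: ifP; rewrite ?scaler0.
rewrite (exchange_big_dep xpredT) //=; apply: eq_bigr => v _.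
pose m := FMonom (map color v).
rewrite -scaler_suml; congr (_ *: _).
rewrite (eq_bigl (pred1 m)) => [|w]; last first.
  by rewrite /= fmP eq_sym.
have [fm|nfm] := boolP (m \in msupp f); last first.
  rewrite big1_seq => [|w /= /andP[/eqP ->]]; last by rewrite (negPf nfm).
  by rewrite mcoeff_outdom.
by rewrite -big_filter filter_pred1_uniq ?fset_uniq // big_seq1.
Qed.

End Multilinearization.

(** * Ideals and the center *)

Section Posner.

Context (C : fieldType) (Q : algType C) (R : set Q).
Hypothesis primeR : prime_ring R.
Hypothesis quotR : symmetric_martindale R.
Hypothesis centerQ : center [set: Q] = scalars Q.
Hypothesis finR : fin_dim R.

Lemma ideal_spans I : nonzero_ideal R I -> forall q, span_of I q.
Proof.
move=> nI q.
have [t [tI It]] := basis_in_subspace (span_of_subspace I)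
  (span_of_fin_dim (fin_dim_sub (fun x => nonzero_ideal_sub nI) finR)).
suff tq : lin_span t q by apply: lin_span_min tq => //; apply: span_of_subspace.
apply: contrapT => /(two_sided_separates primeR quotR centerQ)[s [_ st]].
case/eqP; apply: (two_sided_eq0 primeR quotR centerQ nI) => x Ix.
by apply: (two_sided_span st); apply/It/sub_span_of.
Qed.

Lemma quotient_fin_dim : fin_dim [set: Q].
Proof.
apply: fin_dim_sub (span_of_fin_dim finR) => q _.
exact/ideal_spans/nonzero_ideal_self.
Qed.

Lemma central_closureT : central_closure R = [set: Q].
Proof.
apply/seteqP; split=> // q _.
have [s sR /lin_span_ord[l ->]] := ideal_spans (nonzero_ideal_self primeR) q.
exists (size s), l, (fun i => s`_i); split=> // i.
by apply: sR; apply: mem_nth.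
Qed.

Lemma quotient_simple (I : set Q) : ideal [set: Q] I ->
  (exists2 x, I x & x != 0) -> forall q, I q.
Proof.
move=> [_ I0 IB IM] [x Ix xN] q.
have ID := add_closed I0 IB.
have subI : subspace I.
  split=> // c y z Iy; apply: ID; rewrite -mulr_algl.
  by case: (IM c%:A y).
suff nIR : nonzero_ideal R (I `&` R).
  by apply: span_of_min (ideal_spans nIR q) => // y [].
have RB := prime_ringB primeR; have RM := prime_ringM primeR.
have R0 := prime_ring0 primeR.
split; last first.
  have [J [nJ Jx]] := denominator primeR quotR x.
  have [y Jy yxN] := faithful_l quotR nJ xN; exists (y * x) => //.
  by split; [case: (IM y x) | case: (Jx _ Jy)].
split=> [y []||y z [Iy Ry] [Iz Rz]|a y Ra [Iy Ry]] //.
  by split; [apply: IB | apply: RB].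
by have [? ?] := IM a y Logic.I Iy; do 2!split=> //; apply: RM.
Qed.

(** Separating the first vector of a basis of Q from the others gives a
two-sided multiplication with values in a line C w, and w generates the unit
ideal of the simple ring Q. *)
Lemma rank_one_functional : exists s (l : Q -> C),
  (forall q, two_sided s q = (l q)%:A) /\ exists q, l q != 0.
Proof.
have [bs sbs] := quotient_fin_dim.
have [[|b t] [/= ft st]] := lin_free_exists bs.
  by have /eqP := st _ (sbs 1 Logic.I); rewrite oner_eq0.
have [s [_ stt sbN]] := two_sided_separates primeR quotR centerQ ft.1.
have /choice[l lE] : forall q, exists c, two_sided s q = c *: two_sided s b.
  move=> q; have [c tq] := st _ (sbs q Logic.I); exists c.
  rewrite -[q](subrK (c *: b)) (linear_mapD (two_sided_linear s)).
  rewrite (two_sided_span stt tq) add0r.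
  exact/linear_mapZ/two_sided_linear.
have [u uE] : exists u, two_sided u (two_sided s b) = 1.
  suff : [set x | exists u, x = two_sided u (two_sided s b)] 1.
    by move=> [u ->]; exists u.
  apply: quotient_simple; last first.
    exists (two_sided s b) => //; exists [:: (1, 1)].
    by rewrite /two_sided big_seq1 mul1r mulr1.
  split=> //.
  - by exists [::]; rewrite /two_sided big_nil.
  - move=> _ _ [u ->] [v ->]; exists (u ++ lscale (-1) v).
    by rewrite two_sided_cat two_sided_lscale mulN1r.
  - move=> a _ _ [u ->]; split.
      by exists (lscale a u); rewrite two_sided_lscale.
    by exists (rscale u a); rewrite two_sided_rscale.
exists [seq (p.1 * r.1, r.2 * p.2) | p <- u, r <- s], l; split=> [q|].
  have -> : (l q)%:A = two_sided u (two_sided s q).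
    by rewrite lE (linear_mapZ _ _ (two_sided_linear u)) uE.
  rewrite {1}/two_sided big_allpairs_dep; apply: eq_bigr => p _ /=.
  rewrite mulr_sumr mulr_suml; apply: eq_bigr => r _ /=.
  by rewrite !mulrA.
exists b; apply: contraNneq sbN => l0.
by rewrite lE l0 scale0r.
Qed.

(** With J an ideal of denominators for the coefficients of a scalar-valued
multiplication s, it maps J I J into I. It does not vanish there: otherwise it
would vanish on J Q J, and then on Q since J spans Q. *)
Lemma ideal_meets_center I : nonzero_ideal R I ->
  exists c : C, [/\ c != 0, I c%:A & center R c%:A].
Proof.
move=> nI; have [s [l [sl [q0 lq0]]]] := rank_one_functional.
have [J [nJ Js]] := denominators primeR quotR (map fst s ++ map snd s).
have [idI _] := nI; have [IR I0 IB IM] := idI.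
have ID := add_closed I0 IB.
have sI a b x : J a -> J b -> I x -> I (two_sided s (a * x * b)).
  move=> Ja Jb Ix; rewrite /two_sided big_seq; elim/big_rec: _ => // p z sp Iz.
  apply: ID => //; rewrite !mulrA -[_ * b * _]mulrA.
  have [Rpa _] : R (p.1 * a) /\ R (a * p.1).
    by apply: Js => //; rewrite mem_cat map_f.
  have [_ Rbp] : R (p.2 * b) /\ R (b * p.2).
    by apply: Js => //; rewrite mem_cat map_f ?orbT.
  by case: (IM _ _ Rpa Ix) => Ipx _; case: (IM _ _ Rbp Ipx).
have [a [b [x [Ja Jb Ix sN]]]] : exists a b x,
    [/\ J a, J b, I x & two_sided s (a * x * b) != 0].
  apply: contrapT => no.
  have s0 a b x : J a -> J b -> two_sided s (a * x * b) = 0.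
    move=> Ja Jb; pose s' := [seq (p.1 * a, b * p.2) | p <- s].
    have s'E z : two_sided s' z = two_sided s (a * z * b).
      rewrite /two_sided big_map; apply: eq_bigr => p _ /=.
      by rewrite !mulrA.
    rewrite -s'E; apply: (two_sided_eq0 primeR quotR centerQ nI) => z Iz.
    by apply: contrapT => /eqP N; apply: no; exists a, b, z; rewrite -s'E.
  have lin0 (h : Q -> Q) : linear h ->
      (forall x, J x -> two_sided s (h x) = 0) ->
      forall x, two_sided s (h x) = 0.
    move=> hlin h0 x.
    suff : span_of J `<=` [set x | two_sided s (h x) = 0].
      by apply; apply: ideal_spans.
    apply: span_of_min => //; split=> [|c y z /= hy hz].
      rewrite /= (linear_map0 hlin); exact/linear_map0/two_sided_linear.
    by rewrite hlin two_sided_linear hy hz scaler0 addr0.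
  have s1 a : J a -> forall b x, two_sided s (a * x * b) = 0.
    move=> Ja b x; move: b; apply: lin0 => [c y z|b Jb]; last exact: s0.
    by rewrite mulrDr -scalerAr.
  have s2 x b a : two_sided s (a * x * b) = 0.
    move: a; apply: (lin0 (fun a => a * x * b)) => [c y z|a Ja]; last exact: s1.
    by rewrite !mulrDl -!scalerAl.
  case/eqP: lq0; apply/eqP; have /eqP := s2 q0 1 1.
  by rewrite mul1r mulr1 sl scaler_eq0 oner_eq0 orbF.
exists (l (a * x * b)); have Is := sI _ _ _ Ja Jb Ix; rewrite sl in sN Is.
split=> //; first by apply: contraNneq sN => ->; rewrite scale0r.
by split=> [|y _]; [exact: IR | rewrite mulr_algl mulr_algr].
Qed.

End Posner.

Theorem theorem4p1 (C : fieldType) (Q : algType C) (R : set Q)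
    (primeR : prime_ring R) (centroidC : is_extended_centroid R)
    (piR : PI_ring R) :
  [/\ finite_dimensional (central_closure R) /\
        central_simple (central_closure R),
      forall I : set Q, ideal R I -> I <> [set 0] ->
        I `&` center R <> [set 0],
      center R `<=` scalars Q /\
        field_of_fractions [set c : C | center R c%:A]
    & forall x : Q, central_closure R x ->
        exists (z : C) (r : Q),
          [/\ z != 0, center R z%:A, R r & x = z^-1 *: r]].
Proof.
have [quotR centerQ] := centroidC; have [subR _ _] := primeR.
have [n [c [idc cN]]] := multilinearize subR piR.
have finR := identity_fin_dim primeR quotR centerQ idc cN.
have meet := ideal_meets_center primeR quotR centerQ finR.
have [R0 RB RM] := subR.
(* A central z in the ideal of denominators of q gives q = z^-1 (z q). *)
have fraction q : exists (z : C) (r : Q),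
    [/\ z != 0, center R z%:A, R r & q = z^-1 *: r].
  have [J [nJ Jq]] := denominator primeR quotR q.
  have [z [zN Jz cz]] := meet _ nJ; exists z, (z *: q); split=> //.
    by rewrite -mulr_algr; case: (Jq _ Jz).
  by rewrite scalerK.
rewrite (central_closureT primeR quotR centerQ finR); split=> //.
- split.
    have [bs sbs] := quotient_fin_dim primeR quotR centerQ finR.
    have [t [ft st]] := lin_free_exists bs.
    exists (size t), (fun i => t`_i); split=> // x _.
    have /lin_span_ord[e ->] := st _ (sbs x Logic.I).
    exists [ffun i => e i]; split=> [|d].
      by apply: eq_bigr => i _; rewrite ffunE.
    move=> /eqP; rewrite -subr_eq0 -sumrB => /eqP ed.
    apply/ffunP => i; rewrite ffunE; apply/subr0_eq; move: i.
    apply: (lin_free_coef0 ft); rewrite -[RHS]ed.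
    by apply: eq_bigr => i _; rewrite scalerBl.
  split=> //; split.
    by move=> E; have /eqP : [set 0 : Q] 1; rewrite -?E // oner_eq0.
  move=> I idI; have [_ I0 _ _] := idI.
  have [IN|noI] := pselect (exists2 x, I x & x != 0).
    right; apply/seteqP; split=> // q _.
    exact: (quotient_simple primeR quotR centerQ finR idI IN).
  left; apply: contrapT => /(nonzero_setP I0); exact: noI.
- move=> I idI IN; have [|z [zN Iz cz]] := meet I.
    exact/nonzero_ideal_neq.
  move=> E; have /eqP : [set 0 : Q] z%:A; rewrite -?E //.
  by rewrite scaler_eq0 oner_eq0 orbF (negPf zN).
- split.
    move=> z [_ zR]; have [d ->] := commutes_with_ring primeR quotR centerQ zR.
    by exists d.
  have centerE (d : C) : center R d%:A <-> R d%:A.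
    by split=> [[]//|Rd]; split=> // x _; rewrite mulr_algl mulr_algr.
  split.
    split=> [|x y /centerE Rx /centerE Ry|x y /centerE Rx /centerE Ry].
  + by apply/centerE; rewrite scale0r.
  + by apply/centerE; rewrite scalerBl; apply: RB.
  + by apply/centerE; rewrite -scalerA -mulr_algl; apply: RM.
  move=> d; have [z [r [zN cz Rr dE]]] := fraction d%:A.
  exists (z * d), z; split=> //; last by rewrite mulrAC mulfV // mul1r.
  by apply/centerE; rewrite -scalerA dE scalerA mulfV // scale1r.
Qed.
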